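(* Let $v_0\in\mathbb{R}$, $D>0$, and let $X$ be a square integrable random variable with $\mathbb{P}\{X\in\mathcal{L}(v_0,D)\}=1$, with maximal span $D$. Let $\mu=\mathbb{E}X$ and $\sigma^2=\mathbb{E}X^2-(\mathbb{E}X)^2$, and assume $\sigma^2>0$. Let $\{X_k,k\ge 1\}$ be independent copies of $X$, and put $S_n=X_1+\cdots+X_n$, $n\ge 1$. Then, for any $\kappa\in\mathbb{R}$ and any sequence of integers $\{\kappa_n,n\ge 1\}$ with $\kappa_n\in\mathcal{L}(nv_0,D)$ for all $n\ge 1$ and $$\lim_{n\to\infty}\frac{\kappa_n-n\mu}{\sqrt n}=\kappa,$$ we have, almost surely, $$\lim_{N\to\infty}\frac{1}{\log N}\sum_{n=1}^{N}\frac{1}{\sqrt n}\,\mathbf{1}_{\{S_n=\kappa_n\}}=\frac{D}{\sqrt{2\pi}\,\sigma}\,e^{-\kappa^2/(2\sigma^2)}.$$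
   Context: For $v\in\mathbb{R}$ and $D>0$, $\mathcal{L}(v,D)=\{v+Dk: k\in\mathbb{Z}\}$ denotes the lattice. $D$ is the maximal span of $X$ if $\mathbb{P}\{X\in\mathcal{L}(v_0,D)\}=1$ and there are no $v'\in\mathbb{R}$ and $D'>D$ with $\mathbb{P}\{X\in\mathcal{L}(v',D')\}=1$. *)

(* Defs.v *)
From HB Require Import structures.
From mathcomp Require Import all_boot all_order all_algebra finmap.
From mathcomp Require Import all_classical all_reals all_analysis.

Set Implicit Arguments.
Unset Strict Implicit.
Unset Printing Implicit Defensive.

Import Order.TTheory GRing.Theory Num.Theory.
Import numFieldNormedType.Exports.

Local Open Scope classical_set_scope.
Local Open Scope ring_scope.

Definition lattice (R : realType) (v D : R) : set R :=
  [set v + D * k%:~R | k in [set: int]].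

Definition maximal_span (d : measure_display) (T : measurableType d)
    (R : realType) (P : probability T R) (X : {RV P >-> R}) (v0 D : R) : Prop :=
  P (X @^-1` lattice v0 D) = 1%E /\
  ~ exists v' D' : R, D < D' /\ P (X @^-1` lattice v' D') = 1%E.

Definition mutually_independent (d : measure_display) (T : measurableType d)
    (R : realType) (P : probability T R) (X : nat -> {RV P >-> R}) : Prop :=
  forall (J : {fset nat}) (A : nat -> set R),
    (forall k, k \in J -> measurable (A k)) ->
    P (\bigcap_(k in [set` J]) (X k @^-1` A k)) =
    (\prod_(k <- J) P (X k @^-1` A k))%E.

(* Equality of laws is required on measurable sets only: [distribution P X] is
   a total function whose values elsewhere carry no meaning. *)
Definition same_law (d d' : measure_display) (T : measurableType d)
    (T' : measurableType d') (R : realType) (P : probability T R)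
    (P' : probability T' R) (X : {RV P >-> R}) (Y : {RV P' >-> R}) : Prop :=
  forall A : set R, measurable A -> distribution P X A = distribution P' Y A.

(* [X k] stands for the variable X_(k+1), so that this is X_1 + ... + X_n. *)
Definition partial_sum (d : measure_display) (T : measurableType d)
    (R : realType) (P : probability T R) (X : nat -> {RV P >-> R}) (n : nat)
    (w : T) : R :=
  \sum_(k < n) X k w.

(* Main.v *)
Require Import Defs.
From HB Require Import structures.
From mathcomp Require Import all_boot all_order all_algebra finmap.
From mathcomp Require Import all_classical all_reals all_analysis.
From mathcomp Require Import measurable_realfun complex.
From mathcomp Require Import ring lra.

Set Implicit Arguments.
Unset Strict Implicit.
Unset Printing Implicit Defensive.

Import Order.TTheory GRing.Theory Num.Theory.
Import numFieldNormedType.Exports.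
Import Normc.

Local Open Scope classical_set_scope.
Local Open Scope ring_scope.

(** Write W = (X - mu) / D, psi (t) = E e^(i t W), tau = sigma / D,
x_n = (kappa_n - n mu) / D and B_n = {S_n = kappa_n}.

Since S_n - kappa_n takes its values in D Z, Fourier inversion expresses
P(B_n) as the mean over [-pi, pi] of Re (e^(- i t x_n) psi(t)^n); lemma
[block_prob] states this after the scaling t = u / r, so that the radius r can
be adapted to each estimate.  What has to be known about the law of X is then
contained in three facts about psi.  First, |psi(t)| <= 1 - c t^2 on [-pi, pi]
([charf_lattice_bound]): the integers k for which sin^2 (t k / 2) is bounded by
a multiple of 1 - |psi(t)|, uniformly in t, form a subgroup of Z containing all
the differences of atoms, and maximality of the span D says exactly that no
proper subgroup contains these differences.  Secondly, the two moments give
|1 - psi(t)| <= 2 tau^2 t^2 ([charf_quadratic]), and thirdly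
psi(s / sqrt n)^n --> e^(- tau^2 s^2 / 2) ([charf_power_cvg]).

With dominated convergence and the Fourier transform of the Gaussian
([gaussian_fourier]) this yields the local limit theorem
sqrt n P(B_n) --> D e^(- kappa^2 / (2 sigma^2)) / (sqrt (2 pi) sigma)
([local_limit]), and a bound P(B_n) <= C / sqrt n ([local_bound]).  By
independence of S_m and S_(m+k) - S_m, the covariance of the events B_m and
B_(m+k) is P(B_m) times
P(S_(m+k) - S_m = kappa_(m+k) - kappa_m) - P(S_(m+k) = kappa_(m+k)).
The Fourier integrands of these two probabilities differ by the factor
1 - e^(- i t x_m) psi(t)^m, which is O(|t| sqrt m) because x_m = O(sqrt m);
hence the difference is O(sqrt m / k) ([local_increment]), and the covariance
is both O(1 / k) and O(1 / sqrt (m k)).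

These two bounds make the variance of Z_N = sum_(n <= N) 1_(B_n) / sqrt n a
O(log N) ([variance_le]).  Along N_k = 2^(k^2), where log N_k grows like k^2,
the variances of Z_(N_k) / log N_k are summable, so that Z_N / log N is almost
surely equivalent to its mean along this subsequence; the mean converges by the
local limit theorem, and the gaps are filled because Z_N is nondecreasing in N
and log N_(k+1) / log N_k --> 1 ([ae_log_average]). *)

(** * Joint laws of independent variables *)

Section joint.
Context (R : realType) (d : measure_display) (T : measurableType d)
  (P : probability T R).

(** Conditionally on E, the pair (U, V) has the product law: the normalised
    restriction of its law to E is a measure that agrees with the product on
    rectangles.  The event E carries the variables that do not take part in the
    sum U + V, so that independence from them can be propagated when U and V
    are merged ([indep_tail_block]). *)
Lemma joint_law_product (E : set T) (U V : {RV P >-> R}) : measurable E ->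
  (forall A B, measurable A -> measurable B ->
     P (E `&` (U @^-1` A `&` V @^-1` B)) =
     (P E * (P (U @^-1` A) * P (V @^-1` B)))%E) ->
  forall C, measurable C ->
    P (E `&` (fun w => (U w, V w)) @^-1` C) =
    (P E * (distribution P U \x distribution P V)%E C)%E.
Proof.
move=> mE EUV C mC.
have mUV : measurable_fun setT (fun w => (U w, V w)).
  exact: measurable_fun_pair.
(* A null event makes both sides 0; otherwise P(. | E) can be formed. *)
have [PE0|PE0] := eqVneq (P E) 0%E.
  rewrite PE0 mul0e; apply/eqP; rewrite -measure_le0 -PE0.
  apply: le_measure; rewrite ?inE//.
  by apply: measurableI => //; rewrite -[X in measurable X]setTI; exact: mUV.
have PEfin : P E \is a fin_num by exact: fin_num_measure.
have PEpos : 0 < fine (P E).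
  by rewrite fine_gt0// lt0e PE0 measure_ge0/= ltey_eq PEfin.
pose h : {mfun T >-> (R * R)%type} := mfun_Sub (mem_set mUV).
have c0 : 0 <= (fine (P E))^-1 by rewrite invr_ge0 ltW.
pose m0 := pushforward (mrestr P mE) h : {measure set (R * R) -> \bar R}.
pose m' : {measure set (R * R) -> \bar R} := mscale (NngNum c0) (m0 mUV).
have := @product_measure_unique _ _ _ _ _ (distribution P U) (distribution P V) m' _ C mC.
rewrite /m' /m0 /= /mscale /= /pushforward /mrestr /=.
move=> ->.
  rewrite muleA -[X in (X * _ * _)%E](fineK PEfin) -EFinM divff ?gt_eqF// mul1e.
  by rewrite setIC.
move=> A B mA mB.
rewrite (_ : _ `&` E = E `&` (U @^-1` A `&` V @^-1` B)); last first.
  by rewrite setIC.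
rewrite EUV// muleA -[X in (_ * X * _)%E](fineK PEfin) -EFinM mulVf ?gt_eqF//.
by rewrite mul1e.
Qed.

Lemma bounded_integrable d' (T' : measurableType d') (m : {measure set T' -> \bar R})
    (A : set T') (f : T' -> R) (M : R) :
  measurable A -> (m A < +oo)%E -> measurable_fun A f ->
  (forall x, A x -> `|f x| <= M) -> m.-integrable A (EFin \o f).
Proof.
move=> mA finA mf fM; apply: measurable_bounded_integrable => //.
exists M; split; first exact: num_real.
by move=> N MN x Ax /=; apply: le_trans (fM x Ax) (ltW MN).
Qed.

Lemma prob_bounded_integrable d' (T' : measurableType d') (m : probability T' R)
    (f : T' -> R) (M : R) :
  measurable_fun setT f -> (forall x, `|f x| <= M) ->
  m.-integrable setT (EFin \o f).
Proof.
move=> mf fM; apply: (@bounded_integrable _ _ m _ _ M) => //.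
by apply: le_lt_trans (probability_le1 m measurableT) (ltry 1).
Qed.

Lemma Rintegral_mul_indep (U V : {RV P >-> R}) (f g : R -> R) (M : R) :
  (forall A B, measurable A -> measurable B ->
     P (U @^-1` A `&` V @^-1` B) = (P (U @^-1` A) * P (V @^-1` B))%E) ->
  measurable_fun setT f -> measurable_fun setT g ->
  (forall x, `|f x| <= M) -> (forall x, `|g x| <= M) ->
  (\int[P]_w (f (U w) * g (V w)) =
   (\int[P]_w f (U w)) * (\int[P]_w g (V w)))%R.
Proof.
move=> UV mf mg fM gM.
have M0 : 0 <= M by apply: le_trans (fM 0).
have mUV : measurable_fun setT (fun w => (U w, V w)).
  exact: measurable_fun_pair.
pose h : {mfun T >-> (R * R)%type} := mfun_Sub (mem_set mUV).
pose k (z : R * R) : R := f z.1 * g z.2.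
have mk : measurable_fun setT k.
  by apply: measurable_funM; apply: measurableT_comp => //; exact: measurable_fst.
have kM z : `|k z| <= M * M by rewrite normrM ler_pM.
have fi (m : probability R R) (f' : R -> R) : measurable_fun setT f' ->
    (forall x, `|f' x| <= M) -> m.-integrable setT (EFin \o f').
  by move=> mf' f'M; exact: (@prob_bounded_integrable _ _ m _ M).
have law := joint_law_product (E := setT) (U := U) (V := V).
have {}law : forall C, measurable C ->
    P (h @^-1` C) = (distribution P U \x distribution P V)%E C.
  move=> C mC; have := law measurableT _ C mC.
  rewrite setTI probability_setT mul1e; apply=> A B mA mB.
  by rewrite setTI mul1e UV.
have ik : (distribution P U \x distribution P V)%E.-integrable setT (EFin \o k).
  apply: (@bounded_integrable _ _ _ _ _ (M * M)) => //.
  have := law setT measurableT; rewrite preimage_setT probability_setT => l1.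
  by move: (ltry (1 : R)); congr (is_true (_ < _)%E); exact: l1.
have ikP : P.-integrable setT ((EFin \o k) \o h).
  apply: (@prob_bounded_integrable _ _ P (k \o h) (M * M)); last by move=> ?; exact: kM.
  exact: measurableT_comp.
have intU : (\int[P]_w f (U w) = \int[distribution P U]_x f x)%R.
  rewrite /Rintegral integral_distribution//; first exact/measurable_EFinP.
  apply: (@prob_bounded_integrable _ _ P (f \o U) M); last by move=> ?; exact: fM.
  exact: measurableT_comp.
have intV : (\int[P]_w g (V w) = \int[distribution P V]_x g x)%R.
  rewrite /Rintegral integral_distribution//; first exact/measurable_EFinP.
  apply: (@prob_bounded_integrable _ _ P (g \o V) M); last by move=> ?; exact: gM.
  exact: measurableT_comp.
have mkE : measurable_fun setT (EFin \o k) by exact/measurable_EFinP.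
have := integral12_prod_meas1 ik.
rewrite -[RHS](_ : \int[distribution P h]_z (EFin \o k) z = _)%E; last first.
  by apply: eq_measure_integral => C mC _; exact: law.
rewrite (integral_distribution mkE ikP) /fubini_F /=.
move=> kE.
rewrite /Rintegral -[LHS]/(fine (\int[P]_x (k (U x, V x))%:E)) -kE.
rewrite -!/(Rintegral _ _ _) intU intV.
transitivity (fine (\int[distribution P U]_x ((f x * \int[distribution P V]_y g y)%R)%:E)).
  congr fine; apply: eq_integral => x _.
  rewrite -[LHS]fineK/k/=.
    by congr EFin; rewrite -[LHS]/(Rintegral _ _ _) RintegralZl//; exact: fi.
  have : (distribution P V).-integrable setT (fun y => (f x * g y)%:E).
    apply: (@prob_bounded_integrable _ _ _ (fun y => f x * g y) (M * M)).
    - exact: measurable_funM.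
    - by move=> y; rewrite normrM ler_pM.
  by move/integrable_fin_num => /(_ measurableT).
by rewrite -[LHS]/(Rintegral _ _ _) RintegralZr//; exact: fi.
Qed.

End joint.

(** * Independence of consecutive blocks *)

Section blocks.
Context (R : realType) (d : measure_display) (T : measurableType d)
  (P : probability T R) (X_ : nat -> {RV P >-> R}).

Lemma measurable_block m n :
  measurable_fun setT (fun w => \sum_(m <= k < n) X_ k w).
Proof. by apply: measurable_sum. Qed.

Definition block m n : {RV P >-> R} := mfun_Sub (mem_set (measurable_block m n)).

Lemma blockE m n w : block m n w = \sum_(m <= k < n) X_ k w.
Proof. by []. Qed.

(** Independence of the event E from the variables of index at least m,
    in the form of a product rule: this is what the induction of
    [indep_tail_block] needs, and it avoids generated sigma-algebras. *)
Definition indep_tail (E : set T) (m : nat) : Prop :=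
  forall (J : {fset nat}) (A : nat -> set R),
    (forall k, k \in J -> (m <= k)%N) ->
    (forall k, k \in J -> measurable (A k)) ->
    P (E `&` \bigcap_(k in [set` J]) (X_ k @^-1` A k)) =
    (P E * \prod_(k <- J) P (X_ k @^-1` A k))%E.

Lemma measurable_RV_preimage (Y : {RV P >-> R}) (A : set R) :
  measurable A -> measurable (Y @^-1` A).
Proof. by move=> mA; rewrite -[X in measurable X]setTI; exact: measurable_funP. Qed.

(** The block [m, n) is absorbed one variable at a time: at step n the law
    of the pair (block m n, X_n) is a product also in the presence of E and of
    finitely many later variables, and the law of block m n.+1 is the image of
    this product under addition. *)
Lemma indep_tail_block m n : (m <= n)%N ->
  mutually_independent X_ ->
  forall E, measurable E -> indep_tail E m ->
  forall B, measurable B ->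
    indep_tail (E `&` block m n @^-1` B) n /\
    P (E `&` block m n @^-1` B) = (P E * P (block m n @^-1` B))%E.
Proof.
move=> + indX; have indT k : indep_tail setT k.
  by move=> J A _ mA; rewrite setTI probability_setT mul1e indX.
have base : forall E, measurable E -> indep_tail E m ->
  forall B, measurable B ->
    indep_tail (E `&` block m m @^-1` B) m /\
    P (E `&` block m m @^-1` B) = (P E * P (block m m @^-1` B))%E.
  move=> E mE indE B mB.
  have -> : block m m @^-1` B = if 0 \in B then setT else set0.
    rewrite -preimage_cst; apply: (congr1 (fun f : T -> R => f @^-1` B)).
    by apply/funext => w; rewrite blockE big_geq.
  case: ifPn => _; first by rewrite setIT probability_setT mule1.
  rewrite setI0 measure0 mule0; split => // J A _ mA.
  by rewrite set0I measure0 mul0e.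
elim: n => [|n IH].
  by rewrite leqn0 => /eqP m0; rewrite m0 in base *.
rewrite leq_eqVlt => /predU1P[mE|]; first by rewrite mE in base *.
rewrite ltnS => mn.
have {}IH := IH mn.
pose add2 (z : R * R) := z.1 + z.2.
have madd2 : measurable_fun setT add2.
  by apply: measurable_funD; [exact: measurable_fst|exact: measurable_snd].
have blockS w : block m n.+1 w = add2 (block m n w, X_ n w).
  by rewrite blockE big_nat_recr.
have preS B : block m n.+1 @^-1` B =
    (fun w => (block m n w, X_ n w)) @^-1` (add2 @^-1` B).
  rewrite -comp_preimage; apply: (congr1 (fun f : T -> R => f @^-1` B)).
  by apply/funext => w; exact: blockS.
have key E : measurable E -> indep_tail E m -> forall (J : {fset nat}) A,
    (forall k, k \in J -> (n.+1 <= k)%N) ->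
    (forall k, k \in J -> measurable (A k)) -> forall B, measurable B ->
    P ((E `&` \bigcap_(k in [set` J]) (X_ k @^-1` A k))
        `&` block m n.+1 @^-1` B) =
    (P E * \prod_(k <- J) P (X_ k @^-1` A k) *
      (distribution P (block m n) \x distribution P (X_ n)) (add2 @^-1` B))%E.
  move=> mE indE J A Jn mA B mB.
  have mF : measurable (E `&` \bigcap_(k in [set` J]) (X_ k @^-1` A k)).
    apply: measurableI => //; apply: fin_bigcap_measurable => [|k kJ]; first exact: finite_fset.
    apply: measurable_RV_preimage; exact: (mA k kJ).
  rewrite preS joint_law_product//; last first.
    by rewrite -[X in measurable X]setTI; exact: madd2.
    move=> A0 B0 mA0 mB0.
    have [ind1 ind2] := IH _ mE indE _ mA0.
    (* The event X_n \in B0 is added to the family of later events, so that the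
       induction hypothesis at n yields the three-fold product. *)
    pose A' k := if k == n then B0 else A k.
    have nJ : n \notin J by apply/negP => /Jn; rewrite ltnn.
    have := ind1 (n |` J)%fset A'.
    have A'n : A' n = B0 by rewrite /A' eqxx.
    rewrite big_fsetU1//= ind2 A'n.
    have -> : (\prod_(i <- J) P (X_ i @^-1` A' i) =
        \prod_(i <- J) P (X_ i @^-1` A i))%E.
      apply: eq_big_seq => i iJ; rewrite /A'; case: eqP => // iE.
      by move: nJ; rewrite -iE iJ.
    have -> : E `&` block m n @^-1` A0 `&`
        \bigcap_(k in [set` (n |` J)%fset]) X_ k @^-1` A' k =
        E `&` \bigcap_(k in [set` J]) X_ k @^-1` A k `&`
          (block m n @^-1` A0 `&` X_ n @^-1` B0).
      apply/seteqP; split=> w.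
        move=> [[Ew Vw] H]; split; split => //.
          move=> k /= kJ; have := H k; rewrite /= in_fsetU kJ orbT => /(_ isT).
          rewrite /A'; case: eqP => // kE; by move: nJ; rewrite -kE kJ.
        by have := H n; rewrite /= in_fsetU in_fset1 eqxx A'n => /(_ isT).
      move=> [[Ew H] [Vw Xw]]; split => // k /=.
      rewrite in_fsetU in_fset1 /A'; case: eqP => [-> //|_ /=]; exact: H.
    rewrite indE//; last by move=> k /Jn; apply: leq_trans; exact: leqW.
    move=> ->; last 2 first.
    - by move=> k; rewrite in_fsetU in_fset1 => /orP[/eqP -> //|/Jn/ltnW].
    - move=> k; rewrite in_fsetU in_fset1 /A'; case: eqP => // _ /=; exact: mA.
    rewrite -!muleA; congr (_ * _)%E.
    by rewrite [RHS]muleC -!muleA.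
  rewrite indE//; last by move=> k /Jn; apply: leq_trans; exact: leqW.
have key0 E : measurable E -> indep_tail E m -> forall B, measurable B ->
    P (E `&` block m n.+1 @^-1` B) =
    (P E * (distribution P (block m n) \x distribution P (X_ n)) (add2 @^-1` B))%E.
  move=> mE indE B mB.
  have := key _ mE indE fset0 (fun=> set0).
  rewrite big_seq_fset0 mule1 (_ : \bigcap_(k in _) _ = setT); last first.
    by apply/seteqP; split=> // w _ k.
  rewrite setIT; exact.
have keyT B : measurable B -> P (block m n.+1 @^-1` B) =
    (distribution P (block m n) \x distribution P (X_ n))%E (add2 @^-1` B).
  move=> mB; have := key0 _ measurableT (indT m) _ mB.
  by rewrite setTI probability_setT mul1e.
move=> E mE indE B mB; split; last by rewrite key0// keyT.
move=> J A Jn mA.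
rewrite setIAC key// key0//.
by rewrite -!muleA; congr (_ * _)%E; rewrite muleC.
Qed.

Hypothesis indX : mutually_independent X_.

Let indT k : indep_tail setT k.
Proof. by move=> J A _ mA; rewrite setTI probability_setT mul1e indX. Qed.

(** [indep_tail_block] is used twice: first the initial block is shown
    independent of the later variables, then it plays the role of E. *)
Lemma block_indep m n A B : (m <= n)%N -> measurable A -> measurable B ->
  P (block 0 m @^-1` A `&` block m n @^-1` B) =
  (P (block 0 m @^-1` A) * P (block m n @^-1` B))%E.
Proof.
move=> mn mA mB.
have [ind _] := indep_tail_block (leq0n m) indX measurableT (@indT 0) mA.
rewrite setTI in ind.
by have [] := indep_tail_block mn indX (measurable_RV_preimage _ mA) ind mB.
Qed.

Lemma block_next_indep m n A B : (m <= n)%N -> measurable A -> measurable B ->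
  P (block m n @^-1` A `&` X_ n @^-1` B) =
  (P (block m n @^-1` A) * P (X_ n @^-1` B))%E.
Proof.
move=> mn mA mB.
have [+ _] := indep_tail_block mn indX measurableT (@indT m) mA.
move=> /(_ [fset n]%fset (fun=> B)).
rewrite big_seq_fset1 setTI set_fset1 bigcap_set1; apply.
- by move=> k; rewrite in_fset1 => /eqP ->.
- by [].
Qed.

End blocks.

(** * Elementary trigonometric bounds *)

Section trig.
Context (R : realType).
Implicit Types x y t : R.

Lemma normr_sin_le x : `|sin x| <= `|x|.
Proof.
wlog x0 : x / 0 <= x => [H|].
  have [/H//|/ltW x0] := leP 0 x.
  by have := H (- x); rewrite sinN !normrN oppr_ge0; apply.
have dsin y : y \in `]0, x[ -> is_derive y 1 (@sin R) (cos y).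
  by move=> _; exact: is_derive_sin.
have ct : {within `[0, x], continuous (@sin R)}.
  by apply: continuous_subspaceT; exact: continuous_sin.
have [c _] := MVT_segment x0 dsin ct.
rewrite sin0 !subr0 => ->; rewrite normrM.
by rewrite ler_piMl// cos_max.
Qed.

Lemma one_sub_cos x : 1 - cos x = 2 * sin (x / 2) ^+ 2.
Proof.
have -> : cos x = cos ((x / 2) *+ 2) by congr cos; field.
rewrite cos_mulr2n cos2sin2 mulr2n; ring.
Qed.

Lemma one_sub_cos_le x : `|1 - cos x| <= x ^+ 2 / 2.
Proof.
have s0 : 0 <= sin (x / 2) ^+ 2 by exact: sqr_ge0.
rewrite one_sub_cos ger0_norm; last by lra.
have : sin (x / 2) ^+ 2 <= (x / 2) ^+ 2.
  rewrite -[sin _ ^+ 2]real_normK ?num_real// -[(x / 2) ^+ 2]real_normK ?num_real//.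
  by rewrite lerXn2r ?nnegrE// normr_sin_le.
by rewrite exprMn; lra.
Qed.

(** The mean value theorem for sin - id, in a form that also covers
    negative x; the two polynomial bounds below follow by bounding 1 - cos c in
    two ways. *)
Lemma sin_sub_id x : exists2 c, `|c| <= `|x| & sin x - x = (cos c - 1) * x.
Proof.
wlog x0 : x / 0 <= x => [H|].
  have [/H//|/ltW x0] := leP 0 x.
  have [|c cx E] := H (- x); first by rewrite oppr_ge0.
  exists c; first by move: cx; rewrite normrN.
  by move: E; rewrite sinN; lra.
have df y : y \in `]0, x[ -> is_derive y 1 ((@sin R) \- id) (cos y - 1).
  by move=> _; apply: is_deriveB.
have ct : {within `[0, x], continuous ((@sin R) \- id)}.
  apply: continuous_subspaceT => y; apply: continuousB; first exact: continuous_sin.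
  exact: cvg_id.
have [c cx] := MVT_segment x0 df ct.
rewrite /= sin0 !subr0 => ->.
exists c => //.
by move: cx; rewrite in_itv/= => /andP[c0 cx]; rewrite !ger0_norm.
Qed.

Lemma sin_sub_id_le2 x : `|sin x - x| <= x ^+ 2.
Proof.
have [c cx ->] := sin_sub_id x.
rewrite normrM -[leRHS]real_normK ?num_real// expr2 ler_wpM2r//.
rewrite distrC one_sub_cos normrM (@ger0_norm _ 2)// normrX.
have h1 := normr_sin_le (c / 2).
have h2 : `|sin (c / 2)| <= 1 by exact: sin_max.
have h3 : `|c / 2| = `|c| / 2 by rewrite normrM (@gtr0_norm _ (2^-1)).
have h4 := normr_ge0 (sin (c / 2)).
rewrite h3 in h1; nra.
Qed.

Lemma sin_sub_id_le3 x : `|sin x - x| <= `|x| ^+ 3 / 2.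
Proof.
have [c cx ->] := sin_sub_id x.
rewrite normrM exprSr mulrAC ler_wpM2r// distrC (le_trans (one_sub_cos_le c))//.
rewrite -[c ^+ 2]real_normK ?num_real//.
have := normr_ge0 c; nra.
Qed.

(** With 1 - cos x = 2 sin^2 (x / 2) the left-hand side is a difference
    of squares, so that only a first-order expansion of sin is required. *)
Lemma cos_taylor_le x : `|1 - cos x - x ^+ 2 / 2| <= x ^+ 4.
Proof.
rewrite one_sub_cos.
have -> : 2 * sin (x / 2) ^+ 2 - x ^+ 2 / 2 =
    2 * ((sin (x / 2) - x / 2) * (sin (x / 2) + x / 2)) by field.
rewrite !normrM (@ger0_norm _ 2)//.
have h1 := sin_sub_id_le3 (x / 2).
have h2 : `|sin (x / 2) + x / 2| <= 2 * `|x / 2|.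
  by rewrite (le_trans (ler_normD _ _))//; have := normr_sin_le (x / 2); lra.
have -> : x ^+ 4 = (16%:R) * (`|x / 2| ^+ 3 * `|x / 2|).
  rewrite -exprSr -[in RHS]normrX ger0_norm; last by rewrite exprn_even_ge0.
  by field.
have := normr_ge0 (sin (x / 2) - x / 2); have := normr_ge0 (sin (x / 2) + x / 2).
have : 0 <= `|x / 2| ^+ 3 by rewrite exprn_ge0.
have := normr_ge0 (x / 2).
move: h1 h2; set a := `|x / 2|; set b := `|_ - _|; set c := `|_ + _|; set e := a ^+ 3.
move=> h1 h2 a0 e0 c0 b0.
have : b * c <= e * (2 * a) by rewrite ler_pM//; lra.
nra.
Qed.

(** A crude form of Jordan's inequality; the doubling formula brings the
    argument into [0, 1], where the cubic bounds are positive. *)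
Lemma sin_ge_quarter x : 0 <= x <= 2 -> x / 4 <= sin x.
Proof.
move=> /andP[x0 x2].
have -> : sin x = sin ((x / 2) *+ 2) by congr sin; field.
rewrite sin_mulr2n mulr2n; set y := x / 2.
have y0 : 0 <= y by rewrite /y; lra.
have y1 : y <= 1 by rewrite /y; lra.
have := one_sub_cos_le y; rewrite ler_norml => /andP[_ h1].
have := sin_sub_id_le3 y; rewrite ler_norml (ger0_norm y0) => /andP[h2 _].
have yy : y ^+ 2 <= 1 by rewrite expr_le1.
have y3 : y ^+ 3 <= y by rewrite exprS ler_piMr.
have hc : 1 / 2 <= cos y by lra.
have hs : y / 2 <= sin y by lra.
have -> : x / 4 = 2 * (1 / 2 * (y / 2)) by rewrite /y; field.
have : 1 / 2 * (y / 2) <= cos y * sin y by rewrite ler_pM//; lra.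
lra.
Qed.

End trig.

(** * Characteristic functions *)

Section cis.
Context (R : realType).
Implicit Types (x y t : R) (z : complex R).

Definition cis x : complex R := Complex (cos x) (sin x).

Lemma cis0 : cis 0 = 1.
Proof. by rewrite /cis cos0 sin0. Qed.

Lemma cisD x y : cis (x + y) = cis x * cis y.
Proof.
by apply/eqP; rewrite eq_complex/= cosD sinD eqxx/= addrC [cos x * _]mulrC mulrC.
Qed.

Lemma normc_cis x : normc (cis x) = 1.
Proof. by rewrite /= cos2Dsin2 sqrtr1. Qed.

Lemma normc_ge0 z : 0 <= normc z.
Proof. by case: z => a b; exact: sqrtr_ge0. Qed.

Lemma normcX z n : normc (z ^+ n) = normc z ^+ n.
Proof.
elim: n => [|n IH]; first by rewrite !expr0 normc1.
by rewrite !exprS normcM IH.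
Qed.

Lemma normc_sqr a b : normc (Complex a b : complex R) ^+ 2 = a ^+ 2 + b ^+ 2.
Proof. by rewrite /= sqr_sqrtr// addr_ge0// sqr_ge0. Qed.

Lemma normc_le_add a b : normc (Complex a b : complex R) <= `|a| + `|b|.
Proof.
rewrite -(@ler_pXn2r _ 2)// ?nnegrE ?normc_ge0 ?addr_ge0// normc_sqr sqrrD.
rewrite !real_normK ?num_real// addrAC lerDl.
by rewrite mulrn_wge0// mulr_ge0.
Qed.

Lemma normr_Re_le z : `|complex.Re z| <= normc z.
Proof.
case: z => a b; rewrite -(@ler_pXn2r _ 2)// ?nnegrE ?normc_ge0//.
by rewrite normc_sqr real_normK ?num_real//= lerDl sqr_ge0.
Qed.

Lemma normc_real x : normc (Complex x 0) = `|x|.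
Proof. by rewrite /= expr0n/= addr0 sqrtr_sqr. Qed.

Lemma ler_normcD (z1 z2 : complex R) : normc (z1 + z2) <= normc z1 + normc z2.
Proof. exact: le_normcD. Qed.

Lemma normc_opp z : normc (- z) = normc z.
Proof. exact: normcN. Qed.

(** Telescoping: on the unit disc taking n-th powers is n-Lipschitz. *)
Lemma normc_subX (z1 z2 : complex R) n : normc z1 <= 1 -> normc z2 <= 1 ->
  normc (z1 ^+ n - z2 ^+ n) <= n%:R * normc (z1 - z2).
Proof.
move=> z1_1 z2_1; elim: n => [|n IH]; first by rewrite !expr0 subrr normc0 mul0r.
have -> : z1 ^+ n.+1 - z2 ^+ n.+1 =
    z1 * (z1 ^+ n - z2 ^+ n) + (z1 - z2) * z2 ^+ n by rewrite !exprS; ring.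
rewrite (le_trans (ler_normcD _ _))// !normcM -natr1 mulrDl mul1r lerD//.
  by rewrite (le_trans _ IH)// ler_piMl// normc_ge0.
by rewrite ler_piMr ?normc_ge0// normcX exprn_ile1// normc_ge0.
Qed.

Lemma normc_cis_sub1 x : normc (cis x - 1) <= `|x|.
Proof.
rewrite -(@ler_pXn2r _ 2)// ?nnegrE ?normc_ge0//.
rewrite (_ : cis x - 1 = Complex (cos x - 1) (sin x)); last first.
  by apply/eqP; rewrite eq_complex/= subr0 !eqxx.
rewrite normc_sqr real_normK ?num_real//.
have := one_sub_cos_le x; rewrite ler_norml => /andP[_].
have := cos2Dsin2 x; nra.
Qed.

(** The polar direction of a + i b, with an arbitrary choice at 0. *)
Lemma unit_dir a b : exists e f : R, e ^+ 2 + f ^+ 2 = 1 /\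
  e * a + f * b = normc (Complex a b : complex R).
Proof.
set r := normc _; have r2 : r ^+ 2 = a ^+ 2 + b ^+ 2 by exact: normc_sqr.
have [r0|r0] := eqVneq r 0.
  exists 1, 0; split; first by ring.
  have : a ^+ 2 + b ^+ 2 = 0 by rewrite -r2 r0 expr0n.
  move/eqP; rewrite paddr_eq0 ?sqr_ge0// !sqrf_eq0 => /andP[/eqP -> /eqP ->].
  by rewrite r0; ring.
exists (a / r), (b / r); split.
  by rewrite !expr_div_n -mulrDl -r2 divff// sqrf_eq0.
by rewrite mulrAC [b / r * b]mulrAC -mulrDl -!expr2 -r2 expr2 mulfK.
Qed.

End cis.

Section integrable_real.
Context (R : realType) (d : measure_display) (T : measurableType d)
  (m : {measure set T -> \bar R}) (A : set T).
Hypothesis mA : measurable A.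

Lemma integrableZlR k (f : T -> R) : m.-integrable A (EFin \o f) ->
  m.-integrable A (EFin \o (fun w => k * f w)).
Proof.
move=> fi; have := integrableZl mA k fi.
by apply: eq_integrable => // w _; rewrite /= EFinM.
Qed.

Lemma integrableDR (f g : T -> R) :
  m.-integrable A (EFin \o f) -> m.-integrable A (EFin \o g) ->
  m.-integrable A (EFin \o (fun w => f w + g w)).
Proof.
move=> fi gi; have := integrableD mA fi gi.
by apply: eq_integrable => // w _; rewrite /= EFinD.
Qed.

Lemma integrableBR (f g : T -> R) :
  m.-integrable A (EFin \o f) -> m.-integrable A (EFin \o g) ->
  m.-integrable A (EFin \o (fun w => f w - g w)).
Proof.
move=> fi gi; have := integrableB mA fi gi.
by apply: eq_integrable => // w _; rewrite /= EFinB.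
Qed.

End integrable_real.

Section charf.
Context (R : realType) (d : measure_display) (T : measurableType d)
  (P : probability T R).
Implicit Types (f : T -> R) (t : R).

Definition charf f t : complex R :=
  Complex (\int[P]_w cos (t * f w)) (\int[P]_w sin (t * f w)).

Lemma measurable_cos_mul f t : measurable_fun setT f ->
  measurable_fun setT (fun w => cos (t * f w)).
Proof.
move=> mf; apply: measurableT_comp.
  by apply: continuous_measurable_fun; exact: continuous_cos.
exact: measurable_funM.
Qed.

Lemma measurable_sin_mul f t : measurable_fun setT f ->
  measurable_fun setT (fun w => sin (t * f w)).
Proof.
move=> mf; apply: measurableT_comp.
  by apply: continuous_measurable_fun; exact: continuous_sin.
exact: measurable_funM.
Qed.

Lemma integrable_cos_mul f t : measurable_fun setT f ->
  P.-integrable setT (EFin \o (fun w => cos (t * f w))).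
Proof.
move=> mf; apply: (@prob_bounded_integrable _ _ _ P _ 1); first exact: measurable_cos_mul.
by move=> w; exact: cos_max.
Qed.

Lemma integrable_sin_mul f t : measurable_fun setT f ->
  P.-integrable setT (EFin \o (fun w => sin (t * f w))).
Proof.
move=> mf; apply: (@prob_bounded_integrable _ _ _ P _ 1); first exact: measurable_sin_mul.
by move=> w; exact: sin_max.
Qed.

Lemma charf_proj f t e g : measurable_fun setT f ->
  \int[P]_w (e * cos (t * f w) + g * sin (t * f w)) =
  e * complex.Re (charf f t) + g * complex.Im (charf f t).
Proof.
move=> mf; rewrite RintegralD//=.
- by rewrite !RintegralZl//; [exact: integrable_sin_mul|exact: integrable_cos_mul].
- by apply: integrableZlR => //; exact: integrable_cos_mul.
- by apply: integrableZlR => //; exact: integrable_sin_mul.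
Qed.

Lemma Rintegral_cst1 c : \int[P]_w (cst c w) = c.
Proof.
rewrite Rintegral_cst// -[X in _ * X]/(fine (P setT)).
by rewrite probability_setT mulr1.
Qed.

(** Projecting psi(t) on its own direction (e, g) turns the modulus into
    the expectation of a real, linear expression. *)
Lemma one_sub_normc_charf f t : measurable_fun setT f ->
  exists e g : R, e ^+ 2 + g ^+ 2 = 1 /\
    1 - normc (charf f t) = \int[P]_w (1 - (e * cos (t * f w) + g * sin (t * f w))).
Proof.
move=> mf; have [e [g [eg1 eg2]]] := unit_dir (complex.Re (charf f t)) (complex.Im (charf f t)).
exists e, g; split => //.
rewrite RintegralB//=.
- by rewrite (Rintegral_cst1 1) charf_proj// eg2.
- by apply: (@prob_bounded_integrable _ _ _ P _ 1) => // x; rewrite normr1.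
- apply: (@prob_bounded_integrable _ _ _ P _ (`|e| + `|g|)).
    apply: measurable_funD; apply: measurable_funM => //.
    + exact: measurable_cos_mul.
    + exact: measurable_sin_mul.
  move=> w; rewrite (le_trans (ler_normD _ _))// !normrM lerD// ler_piMr//.
  + exact: cos_max.
  + exact: sin_max.
Qed.

Lemma unit_dot_le1 (e g x : R) : e ^+ 2 + g ^+ 2 = 1 -> e * cos x + g * sin x <= 1.
Proof.
move=> eg; have := cos2Dsin2 x; have := sqr_ge0 (e - cos x).
have := sqr_ge0 (g - sin x); nra.
Qed.

Lemma normc_charf_le1 f t : measurable_fun setT f -> normc (charf f t) <= 1.
Proof.
move=> mf; have [e [g [eg1 eg2]]] := one_sub_normc_charf t mf.
rewrite -subr_ge0 eg2; apply: Rintegral_ge0 => w _.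
by rewrite subr_ge0 unit_dot_le1.
Qed.

(** For unit vectors, 1 - a.b = |a - b|^2 / 2; by the parallelogram
    inequality the direction of psi(t) cannot be close to both of the vectors
    e^(itx) and e^(ity), so that each pair of atoms forces a loss in the modulus
    of the characteristic function. *)
Lemma charf_gap f t x y p : measurable_fun setT f -> x != y -> 0 <= p ->
  (p%:E <= P (f @^-1` [set x]))%E -> (p%:E <= P (f @^-1` [set y]))%E ->
  p * sin (t * (x - y) / 2) ^+ 2 <= 1 - normc (charf f t).
Proof.
move=> mf xy p0 px py.
have [e [g [eg ->]]] := one_sub_normc_charf t mf.
pose h (u : R) := 1 - (e * cos (t * u) + g * sin (t * u)).
have h0 u : 0 <= h u by rewrite subr_ge0 unit_dot_le1.
have mpre z : measurable (f @^-1` [set z]).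
  by rewrite -[X in measurable X]setTI; exact: mf.
have ind1 z : P.-integrable setT (EFin \o \1_(f @^-1` [set z])).
  apply: (@prob_bounded_integrable _ _ _ P _ 1); first exact: measurable_indic.
  by move=> w; rewrite indicE; case: (_ \in _); rewrite ?normr1 ?normr0.
have iZ z : P.-integrable setT (EFin \o (fun w => h z * \1_(f @^-1` [set z]) w)).
  exact: integrableZlR.
have Iz z : \int[P]_w (h z * \1_(f @^-1` [set z]) w) = h z * fine (P (f @^-1` [set z])).
  rewrite RintegralZl//; congr (_ * _).
  by rewrite /Rintegral integral_indic// setIT.
have le1 : \int[P]_w (h x * \1_(f @^-1` [set x]) w + h y * \1_(f @^-1` [set y]) w)
    <= \int[P]_w h (f w).
  apply: le_Rintegral => //.
  - by apply: integrableDR.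
  - apply: (@prob_bounded_integrable _ _ _ P _ (1 + (`|e| + `|g|))).
      apply: measurable_funB => //.
      apply: measurable_funD; apply: measurable_funM => //.
      + exact: measurable_cos_mul.
      + exact: measurable_sin_mul.
    move=> w; rewrite (le_trans (ler_normB _ _))// normr1 lerD2l.
    rewrite (le_trans (ler_normD _ _))// !normrM lerD// ler_piMr//.
    + exact: cos_max.
    + exact: sin_max.
  - move=> w _.
    have indz z : \1_(f @^-1` [set z]) w = (f w == z)%:R :> R.
      rewrite indicE; congr (_ %:R); congr nat_of_bool.
      by apply/idP/eqP => [/set_mem//|fz]; exact: mem_set.
    rewrite !indz.
    have [->|fx] := eqVneq (f w) x; first by rewrite (negbTE xy) mulr1 mulr0 addr0.
    have [->|fy] := eqVneq (f w) y; first by rewrite mulr1 mulr0 add0r.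
    by rewrite !mulr0 addr0 h0.
apply: le_trans le1.
rewrite RintegralD// !Iz.
have pf z : (p%:E <= P (f @^-1` [set z]))%E -> p <= fine (P (f @^-1` [set z])).
  by rewrite -lee_fin fineK// fin_num_measure.
have hxy : sin (t * (x - y) / 2) ^+ 2 <= h x + h y.
  have := one_sub_cos (t * (x - y)).
  rewrite mulrBr cosB /h.
  have := cos2Dsin2 (t * x); have := cos2Dsin2 (t * y).
  set c1 := cos (t * x); set s1 := sin (t * x); set c2 := cos (t * y); set s2 := sin (t * y).
  (* These squares express that the midpoint of the two unit vectors is at a
     nonnegative squared distance from (e, g). *)
  have := sqr_ge0 (c1 + c2 - 2 * e); have := sqr_ge0 (s1 + s2 - 2 * g).
  nra.
apply: (@le_trans _ _ (p * (h x + h y))); first by rewrite ler_wpM2l.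
by rewrite mulrDr lerD// mulrC ler_wpM2l// pf.
Qed.

End charf.

(** * The maximal span bounds the characteristic function *)

(** A proper subgroup of Z is g Z for some g other than 1; for the trivial
    subgroup any g > 1 will do. *)
Lemma int_subgroup_dvd (H : int -> Prop) : H 0 ->
  (forall a b, H a -> H b -> H (a - b)) -> ~ H 1 ->
  exists g : nat, (1 < g)%N /\ forall k, H k -> (g %| k)%Z.
Proof.
move=> H0 HB H1.
have HN a : H a -> H (- a) by move=> Ha; rewrite -sub0r; exact: HB.
have HD a b : H a -> H b -> H (a + b).
  by move=> Ha Hb; rewrite -[b]opprK; apply: HB => //; exact: HN.
have HMn a n : H a -> H (a *+ n).
  by move=> Ha; elim: n => [|n IH]; rewrite ?mulr0n// mulrS; exact: HD.
have HM a (z : int) : H a -> H (z * a).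
  move=> Ha; case: z => n; first by rewrite -natz mulr_natl; exact: HMn.
  by rewrite NegzE mulNr; apply: HN; rewrite -natz mulr_natl; exact: HMn.
have [[n [n0 Hn]]|no] := pselect (exists n : nat, (0 < n)%N /\ H n%:Z).
  have ex : exists n, `[< (0 < n)%N /\ H n%:Z >] by exists n; exact/asboolP.
  case: (ex_minnP ex) => g /asboolP[g0 Hg] gmin.
  exists g; split.
    rewrite ltnNge; apply/negP => g1; apply: H1.
    by have -> : 1 = g%:Z; rewrite // (_ : g = 1%N)//; apply/eqP; rewrite eqn_leq g1.
  move=> k Hk; apply/dvdz_mod0P.
  have Hr : H (k %% g)%Z.
    by rewrite /modz; apply: HB => //; exact: HM.
  have r0 : 0 <= (k %% g)%Z by apply: modz_ge0; rewrite -lt0n.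
  have rg : (k %% g)%Z < g by apply: ltz_pmod.
  move: Hr r0 rg; case: (k %% g)%Z => // r Hr _ rg.
  have [r0|r0] := posnP r; first by rewrite r0.
  have := gmin r (asboolT (conj r0 Hr)).
  by rewrite ltz_nat in rg; rewrite leqNgt rg.
(* No positive element: H is trivial. *)
exists 2%N; split => // k Hk.
have [->|k0] := eqVneq k 0; first exact: dvdz0.
exfalso; apply: no; exists `|k|%N; split; first by rewrite absz_gt0.
by case: (lerP 0 k) => [kp|kn]; [rewrite gez0_abs|rewrite ltz0_abs//; exact: HN].
Qed.

Section span.
Context (R : realType) (d : measure_display) (T : measurableType d)
  (P : probability T R).

(** The lattice as a sequence of sets, each a point or empty, indexed by
    the codes of the integers: this is the form that countable additivity
    accepts. *)
Definition lattice_pt (v D : R) (n : nat) : set R :=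
  if choice.unpickle n is Some k then [set v + D * (k : int)%:~R] else set0.

Lemma lattice_bigcup (v D : R) : lattice v D = \bigcup_n lattice_pt v D n.
Proof.
apply/seteqP; split=> [x [k _ <-]|x [n _]].
  by exists (choice.pickle k) => //; rewrite /lattice_pt choice.pickleK.
by rewrite /lattice_pt; case: choice.unpickle => // k ->; exists k.
Qed.

Lemma measurable_lattice_pt v D n : measurable (lattice_pt v D n).
Proof. by rewrite /lattice_pt; case: choice.unpickle => // k; exact: measurable_set1. Qed.

Lemma measurable_lattice v D : measurable (lattice v D : set R).
Proof.
rewrite lattice_bigcup; apply: bigcup_measurable => n _.
exact: measurable_lattice_pt.
Qed.

(** A lattice variable charges only atoms, so a set containing all of them
    has full measure. *)
Lemma lattice_atoms (X : {RV P >-> R}) v D (S : set R) : measurable S ->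
  P (X @^-1` lattice v D) = 1%E ->
  (forall k : int, ~ S (v + D * k%:~R) -> P (X @^-1` [set v + D * k%:~R]) = 0%E) ->
  P (X @^-1` S) = 1%E.
Proof.
move=> mS PL null.
have mX A : measurable A -> measurable (X @^-1` A) by exact: measurable_RV_preimage.
have mL := measurable_lattice v D.
have N0 : P (X @^-1` (lattice v D `\` S)) = 0%E.
  apply/negligibleP; first by apply: mX; exact: measurableD.
  rewrite lattice_bigcup setD_bigcupl preimage_bigcup.
  apply: negligible_bigcup => n; apply/negligibleP.
    by apply: mX; apply: measurableD => //; exact: measurable_lattice_pt.
  rewrite /lattice_pt; case: choice.unpickle => [k|]; last by rewrite set0D preimage_set0.
  have [Sk|Sk] := pselect (S (v + D * k%:~R)).
    by rewrite (_ : _ `\` S = set0) ?preimage_set0//; apply/seteqP; split=> x // [-> ].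
  apply/eqP; rewrite -measure_le0 -(null k Sk); apply: le_measure; rewrite ?inE.
  - by apply: mX; apply: measurableD => //; exact: measurable_set1.
  - by apply: mX; exact: measurable_set1.
  - by move=> w [].
apply/eqP; rewrite eq_le probability_le1/=; last exact: mX.
rewrite -PL -[leRHS]adde0 -N0 -measureU.
- apply: le_measure; rewrite ?inE.
  + exact: mX.
  + by apply: measurableU; apply: mX => //; exact: measurableD.
  + by move=> w Lw; have [Sw|Sw] := pselect (S (X w)); [left|right].
- exact: mX.
- by apply: mX; exact: measurableD.
- by apply/seteqP; split=> w // [Sw []].
Qed.

(** Let H be the set of integers k such that sin^2 (t k / 2) is at most a
    multiple of 1 - |psi(t)|, uniformly in t.  By the addition formula
    for sin, H is a subgroup of Z, and by [charf_gap] it contains k - l whenever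
    v0 + D k and v0 + D l are atoms.  If 1 were not in H, all the differences of
    atoms would be multiples of some g > 1, and X would live on a lattice of
    span g D.  So 1 is in H, and sin^2 (t / 2) >= t^2 / 64 on [-pi, pi].  The
    argument treats t near 0 and t away from 0 at the same time. *)
Lemma charf_lattice_bound (X : {RV P >-> R}) v0 D mu : 0 < D ->
  maximal_span X v0 D ->
  exists c : R, 0 < c /\ forall t, `|t| <= pi ->
    normc (charf P (fun w => (X w - mu) / D) t) <= 1 - c * t ^+ 2.
Proof.
move=> D0 [PL Pmax].
set W := (fun w : T => (X w - mu) / D).
have mW : measurable_fun setT W.
  by apply: measurable_funM => //; apply: measurable_funB.
have D1 : D != 0 by rewrite gt_eqF.
pose H (k : int) := exists C : R, 0 <= C /\ forall t, sin (t * k%:~R / 2) ^+ 2 <= C * (1 - normc (charf P W t)).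
have gap_ge0 t : 0 <= 1 - normc (charf P W t) by rewrite subr_ge0 normc_charf_le1.
have H0 : H 0.
  by exists 0; split => // t; rewrite mulr0 mul0r sin0 expr0n mul0r.
have HB a b : H a -> H b -> H (a - b).
  move=> [C [C0 Ca]] [C' [C'0 Cb]]; exists (2 * (C + C')); split.
    by rewrite mulr_ge0// addr_ge0.
  move=> t; have := Ca t; have := Cb t.
  have -> : t * (a - b)%:~R / 2 = t * a%:~R / 2 - t * b%:~R / 2.
    by rewrite rmorphB/=; field.
  rewrite sinB.
  set x := t * a%:~R / 2; set y := t * b%:~R / 2; set g := 1 - _.
  have := cos2Dsin2 x; have := cos2Dsin2 y.
  set c1 := cos x; set s1 := sin x; set c2 := cos y; set s2 := sin y.
  move=> e2 e1 hy hx.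
  have : (s1 * c2 - c1 * s2) ^+ 2 <= 2 * (s1 ^+ 2 * c2 ^+ 2 + c1 ^+ 2 * s2 ^+ 2).
    have := sqr_ge0 (s1 * c2 + c1 * s2); nra.
  have : s1 ^+ 2 * c2 ^+ 2 <= s1 ^+ 2.
    by rewrite ler_piMr ?sqr_ge0//; have := sqr_ge0 s2; lra.
  have : c1 ^+ 2 * s2 ^+ 2 <= s2 ^+ 2.
    by rewrite ler_piMl ?sqr_ge0//; have := sqr_ge0 s1; lra.
  lra.
pose atom (k : int) := P (X @^-1` [set v0 + D * k%:~R]).
have Watom k : W @^-1` [set (v0 + D * k%:~R - mu) / D] = X @^-1` [set v0 + D * k%:~R].
  apply/seteqP; split=> w; rewrite /preimage/= /W; last by move=> ->.
  by move/(mulIf (invr_neq0 D1))/addIr.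
have atom_fin k : atom k \is a fin_num.
  by apply: fin_num_measure; apply: measurable_RV_preimage; exact: measurable_set1.
have Hatoms k l : atom k != 0%E -> atom l != 0%E -> H (k - l).
  move=> ak al; have [->|kl] := eqVneq k l; first by rewrite subrr.
  have pos j : atom j != 0%E -> 0 < fine (atom j).
    by move=> aj; rewrite fine_gt0// lt0e aj measure_ge0/= ltey_eq atom_fin.
  pose p := Num.min (fine (atom k)) (fine (atom l)).
  have p0 : 0 < p by rewrite /p lt_min !pos.
  exists p^-1; split; first by rewrite invr_ge0 ltW.
  move=> t; rewrite ler_pdivlMl//.
  have -> : (k - l)%:~R = (v0 + D * k%:~R - mu) / D - (v0 + D * l%:~R - mu) / D.
    by rewrite rmorphB/=; field.
  apply: charf_gap => //.
  - apply: contra_neq kl => /(mulIf (invr_neq0 D1))/addIr/addrI/(mulfI D1).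
    by move/eqP; rewrite eqr_int => /eqP.
  - exact: ltW.
  - by rewrite Watom -/(atom k) -(fineK (atom_fin k)) lee_fin /p ge_min lexx.
  - by rewrite Watom -/(atom l) -(fineK (atom_fin l)) lee_fin /p ge_min lexx orbT.
have H1 : H 1.
  apply: contrapT => nH1.
  have [g [g1 gH]] := int_subgroup_dvd H0 HB nH1.
  have [[k0 ak0]|noatom] := pselect (exists k, atom k != 0%E); last first.
    have : P (X @^-1` set0) = 1%E.
      apply: (lattice_atoms measurable0 PL) => k _.
      by apply/eqP; apply: contra_notT noatom => ak; exists k.
    by rewrite preimage_set0 measure0 => /eqP; rewrite eq_sym onee_eq0.
  (* All the atoms are congruent to v0 + D k0 modulo g D, a coarser lattice. *)
  apply: Pmax; exists (v0 + D * k0%:~R), (D * g%:R); split.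
    by rewrite ltr_pMr// ltr1n.
  apply: (lattice_atoms (measurable_lattice _ _) PL) => k nk.
  apply/eqP; apply: contra_notT nk => ak.
  have /dvdzP[q kq] := gH _ (Hatoms _ _ ak ak0).
  exists q => //.
  have -> : k = k0 + q * g by rewrite -kq addrC subrK.
  by rewrite rmorphD/= rmorphM/=; ring.
have [C [C0 HC]] := H1.
(* C + 1 instead of C, which may be 0. *)
exists ((64 * (C + 1))^-1); split; first by rewrite invr_gt0 mulr_gt0// ltr_wpDl.
move=> t tpi.
have := HC t; rewrite mulr1 => h.
have sq : t ^+ 2 / 64 <= sin (t / 2) ^+ 2.
  have := @sin_ge_quarter R (`|t| / 2).
  have -> : sin (t / 2) ^+ 2 = sin (`|t| / 2) ^+ 2.
    by case: (ger0P t) => // _; rewrite mulNr sinN sqrrN.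
  rewrite -[t ^+ 2]real_normK ?num_real// => h4.
  have t2 : 0 <= `|t| / 2 <= 2.
    have := normr_ge0 t; have := @pihalf_lt2 R; lra.
  have := h4 t2; have := normr_ge0 t; nra.
have CC : 0 < C + 1 by rewrite ltr_wpDl.
have : t ^+ 2 / 64 <= (C + 1) * (1 - normc (charf P W t)).
  by rewrite mulrDl mul1r; have := gap_ge0 t; lra.
rewrite -ler_pdivrMl// => h5.
have : (64 * (C + 1))^-1 * t ^+ 2 <= 1 - normc (charf P W t).
  apply: le_trans h5; rewrite invfM le_eqVlt; apply/orP; left; apply/eqP; ring.
lra.
Qed.

End span.

(** * Second-order behaviour of the characteristic function *)

Section convergence.
Context (R : realType).

Lemma cvg_invn : (n%:R^-1 : R) @[n --> \oo] --> 0.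
Proof.
apply/gtr0_cvgV0; last exact: cvgr_idn.
by near=> n; rewrite ltr0n; near: n; exists 1%N.
Unshelve. all: by end_near. Qed.

Lemma cvg_sqrtn : (Num.sqrt n%:R : R) @[n --> \oo] --> +oo.
Proof.
apply/cvgryPge => A; near=> n.
rewrite (le_trans (ler_norm A))// -sqrtr_sqr ler_sqrt//.
by near: n; exact: nbhs_infty_ger.
Unshelve. all: by end_near. Qed.

Lemma cvg_invsqrtn : ((Num.sqrt n%:R)^-1 : R) @[n --> \oo] --> 0.
Proof.
apply/gtr0_cvgV0; last exact: cvg_sqrtn.
by near=> n; rewrite sqrtr_gt0 ltr0n; near: n; exists 1%N.
Unshelve. all: by end_near. Qed.

Lemma Rintegral_dominated_cvg (d : measure_display) (T : measurableType d)
    (m : {measure set T -> \bar R}) (A : set T) (f_ : nat -> T -> R)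
    (f g : T -> R) : measurable A ->
  (forall n, measurable_fun A (f_ n)) ->
  (forall x, A x -> f_ n x @[n --> \oo] --> f x) ->
  m.-integrable A (EFin \o g) ->
  (forall n x, A x -> `|f_ n x| <= g x) ->
  \int[m]_(x in A) f_ n x @[n --> \oo] --> \int[m]_(x in A) f x.
Proof.
move=> mA mf_ f_f ig fg.
have mf : measurable_fun A f by exact: measurable_fun_cvg f_f.
have mfE_ n : measurable_fun A (EFin \o f_ n) by exact/measurable_EFinP.
have mfE : measurable_fun A (EFin \o f) by exact/measurable_EFinP.
have f_fE : {ae m, forall x, A x -> (EFin \o f_ n) x @[n --> \oo] --> (EFin \o f) x}.
  by apply: aeW => x Ax; apply: cvg_EFin; [exact: nearW|exact: f_f].
have fgE : {ae m, forall x n, A x -> (`|(EFin \o f_ n) x| <= (EFin \o g) x)%E}.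
  by apply: aeW => x n Ax; rewrite lee_fin fg.
have [fif _ H] := dominated_convergence mA mfE_ mfE f_fE ig fgE.
by apply: fine_cvg; rewrite fineK//; exact: integrable_fin_num.
Qed.

Lemma cvg_dist_le (f : nat -> R) (e : nat -> R) (l : R) :
  (forall n, (0 < n)%N -> `|f n - l| <= e n) -> e n @[n --> \oo] --> 0 ->
  f n @[n --> \oo] --> l.
Proof.
move=> fe e0; apply/subr_cvg0; apply: norm_cvg0.
apply: (@squeeze_cvgr _ _ _ _ (cst 0) e) => //; last exact: cvg_cst.
near=> n; rewrite normr_ge0/= fe//.
by near: n; exists 1%N.
Unshelve. all: by end_near. Qed.

Lemma cvgMl0 (e : nat -> R) (c : R) :
  e n @[n --> \oo] --> 0 -> c * e n @[n --> \oo] --> 0.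
Proof. by move=> e0; rewrite -[X in _ --> X](mulr0 c); apply: cvgMr. Qed.

Lemma sqrtn_gt0 n : (0 < n)%N -> 0 < Num.sqrt n%:R :> R.
Proof. by move=> n0; rewrite sqrtr_gt0 ltr0n. Qed.

Lemma sqr_sqrtn n : Num.sqrt n%:R ^+ 2 = n%:R :> R.
Proof. by rewrite sqr_sqrtr. Qed.

(** The expansion 1 - e^(-y) = y + O(y^2), with an explicit remainder. *)
Lemma cvg_expRn (a : R) : 0 <= a ->
  n%:R * (1 - expR (- (a / n%:R))) @[n --> \oo] --> a.
Proof.
move=> a0; apply: (@cvg_dist_le _ (fun n => a ^+ 2 * n%:R^-1)).
  move=> n n0; have n1 : 0 < n%:R :> R by rewrite ltr0n.
  set y := a / n%:R; have y0 : 0 <= y by rewrite divr_ge0// ltW.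
  have -> : n%:R * (1 - expR (- y)) - a = n%:R * (1 - expR (- y) - y).
    by rewrite /y; field; rewrite gt_eqF.
  have -> : a ^+ 2 / n%:R = n%:R * y ^+ 2 by rewrite /y; field; rewrite gt_eqF.
  rewrite normrM ger0_norm// ler_wpM2l// ler_norml.
  have h1 := expR_ge1Dx (- y).
  have h2 : expR (- y) <= 1 - y + y ^+ 2.
    rewrite expRN; have p : 0 < 1 + y by lra.
    apply: (@le_trans _ _ (1 + y)^-1).
      by rewrite lef_pV2 ?posrE ?expR_gt0// expR_ge1Dx.
    rewrite -[leLHS]mul1r ler_pdivrMr//.
    have : 0 <= y * y * y by rewrite !mulr_ge0.
    nra.
  by apply/andP; split; have := sqr_ge0 y; lra.
by apply: cvgMl0; exact: cvg_invn.
Qed.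

End convergence.

Section taylor.
Context (R : realType) (d : measure_display) (T : measurableType d)
  (P : probability T R) (W : T -> R) (tau : R).
Hypotheses (mW : measurable_fun setT W)
  (iW : P.-integrable setT (EFin \o W))
  (iW2 : P.-integrable setT (EFin \o (fun w => W w ^+ 2)))
  (EW : \int[P]_w W w = 0) (EW2 : \int[P]_w (W w ^+ 2) = tau ^+ 2).

Lemma Re_charf_sub1 t :
  1 - complex.Re (charf P W t) = \int[P]_w (1 - cos (t * W w)).
Proof.
rewrite RintegralB//=.
- by rewrite (Rintegral_cst1 P 1).
- by apply: (@prob_bounded_integrable _ _ _ _ _ 1) => // x; rewrite normr1.
- exact: integrable_cos_mul.
Qed.

(** Because W is centred, the linear term can be subtracted for free. *)
Lemma Im_charf_sub t :
  complex.Im (charf P W t) = \int[P]_w (sin (t * W w) - t * W w).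
Proof.
rewrite RintegralB//=.
- by rewrite [X in _ - X]RintegralZl// EW mulr0 subr0.
- exact: integrable_sin_mul.
- exact: integrableZlR.
Qed.

(** Both t W - sin (t W) and 1 - cos (t W) are at most (t W)^2 in absolute
    value, and the linear term has mean zero. *)
Lemma charf_quadratic t : normc (1 - charf P W t) <= 2 * tau ^+ 2 * t ^+ 2.
Proof.
have i1 : P.-integrable setT (EFin \o (fun w => 1 - cos (t * W w))).
  apply: integrableBR => //; last exact: integrable_cos_mul.
  by apply: (@prob_bounded_integrable _ _ _ _ _ 1) => // x; rewrite normr1.
have i2 : P.-integrable setT (EFin \o (fun w => sin (t * W w) - t * W w)).
  by apply: integrableBR => //; [exact: integrable_sin_mul|exact: integrableZlR].
have -> : 1 - charf P W t = Complex (1 - complex.Re (charf P W t)) (- complex.Im (charf P W t)).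
  by apply/eqP; rewrite eq_complex /= sub0r !eqxx.
rewrite (le_trans (normc_le_add _ _))// normrN Re_charf_sub1 Im_charf_sub.
have -> : 2 * tau ^+ 2 * t ^+ 2 = t ^+ 2 * tau ^+ 2 + t ^+ 2 * tau ^+ 2 by ring.
have bnd (f : T -> R) : P.-integrable setT (EFin \o f) ->
    (forall w, `|f w| <= t ^+ 2 * W w ^+ 2) -> `|\int[P]_w f w| <= t ^+ 2 * tau ^+ 2.
  move=> fi fb; rewrite (le_trans (le_normr_Rintegral _ fi))//.
  rewrite -EW2 -RintegralZl//; apply: le_Rintegral => //.
  - exact: integrable_abse fi.
  - exact: integrableZlR.
by rewrite lerD// bnd// => w; rewrite -exprMn;
  [rewrite (le_trans (one_sub_cos_le _))//; have := sqr_ge0 (t * W w); lra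
  |exact: sin_sub_id_le2].
Qed.

Lemma cvg_Re_charf s :
  n%:R * (1 - complex.Re (charf P W (s / Num.sqrt n%:R))) @[n --> \oo] -->
  s ^+ 2 * tau ^+ 2 / 2.
Proof.
rewrite (_ : (fun _ => _) = (fun n : nat =>
    \int[P]_w (n%:R * (1 - cos (s / Num.sqrt n%:R * W w))))); last first.
  apply/funext => n; rewrite Re_charf_sub1 RintegralZl//.
  apply: integrableBR => //; last exact: integrable_cos_mul.
  by apply: (@prob_bounded_integrable _ _ _ _ _ 1) => // x; rewrite normr1.
have -> : s ^+ 2 * tau ^+ 2 / 2 = \int[P]_w (s ^+ 2 / 2 * W w ^+ 2).
  by rewrite RintegralZl// EW2 mulrAC.
apply: (@Rintegral_dominated_cvg _ _ _ _ _ _ _ (fun w => s ^+ 2 / 2 * W w ^+ 2)) => //.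
- move=> n; apply: measurable_funM => //; apply: measurable_funB => //.
  exact: measurable_cos_mul.
- move=> w _; apply: (@cvg_dist_le _ _ (fun n => (s * W w) ^+ 4 * n%:R^-1)).
    move=> n n0; have r0 := @sqrtn_gt0 R n n0; have r2 := sqr_sqrtn R n.
    move: r0 r2; set r := Num.sqrt n%:R => r0 r2; rewrite -r2.
    have rn0 : r != 0 by rewrite gt_eqF.
    have -> : r ^+ 2 * (1 - cos (s / r * W w)) - s ^+ 2 / 2 * W w ^+ 2 =
       r ^+ 2 * (1 - cos (s / r * W w) - (s / r * W w) ^+ 2 / 2) by field.
    have -> : (s * W w) ^+ 4 / r ^+ 2 = r ^+ 2 * (s / r * W w) ^+ 4 by field.
    by rewrite normrM ger0_norm ?sqr_ge0// ler_wpM2l ?sqr_ge0// cos_taylor_le.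
  by apply: cvgMl0; exact: cvg_invn.
- exact: integrableZlR.
- move=> n w _; have [->|n0] := posnP n.
    by rewrite mul0r normr0 mulr_ge0 ?sqr_ge0// divr_ge0 ?sqr_ge0.
  have r0 := @sqrtn_gt0 R n n0; have r2 := sqr_sqrtn R n.
  move: r0 r2; set r := Num.sqrt n%:R => r0 r2; rewrite -r2.
  have -> : s ^+ 2 / 2 * W w ^+ 2 = r ^+ 2 * ((s / r * W w) ^+ 2 / 2).
    by field; rewrite gt_eqF.
  by rewrite normrM ger0_norm ?sqr_ge0// ler_wpM2l ?sqr_ge0// one_sub_cos_le.
Qed.

Lemma cvg_Im_charf s :
  n%:R * complex.Im (charf P W (s / Num.sqrt n%:R)) @[n --> \oo] --> 0.
Proof.
rewrite (_ : (fun _ => _) = (fun n : nat =>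
    \int[P]_w (n%:R * (sin (s / Num.sqrt n%:R * W w) - s / Num.sqrt n%:R * W w)))); last first.
  apply/funext => n; rewrite Im_charf_sub RintegralZl//.
  by apply: integrableBR => //; [exact: integrable_sin_mul|exact: integrableZlR].
have -> : 0 = \int[P]_w (cst 0 w) :> R by rewrite (Rintegral_cst1 P 0).
apply: (@Rintegral_dominated_cvg _ _ _ _ _ _ _ (fun w => s ^+ 2 * W w ^+ 2)) => //.
- move=> n; apply: measurable_funM => //; apply: measurable_funB => //.
    exact: measurable_sin_mul.
  exact: measurable_funM.
- move=> w _; apply: (@cvg_dist_le _ _ (fun n => `|s * W w| ^+ 3 * (Num.sqrt n%:R)^-1)).
    move=> n n0; have r0 := @sqrtn_gt0 R n n0; have r2 := sqr_sqrtn R n.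
    move: r0 r2; set r := Num.sqrt n%:R => r0 r2; rewrite -r2.
    have rn0 : r != 0 by rewrite gt_eqF.
    rewrite subr0 normrM ger0_norm ?sqr_ge0//.
    have -> : `|s * W w| ^+ 3 / r = r ^+ 2 * `|s / r * W w| ^+ 3.
      have -> : s / r * W w = r^-1 * (s * W w) by field.
      rewrite [in RHS]normrM (@gtr0_norm _ r^-1) ?invr_gt0//.
      by move: `|s * W w| => u; field.
    rewrite ler_wpM2l ?sqr_ge0// (le_trans (sin_sub_id_le3 _))//.
    have : 0 <= `|s / r * W w| ^+ 3 by rewrite exprn_ge0.
    lra.
  by apply: cvgMl0; exact: cvg_invsqrtn.
- exact: integrableZlR.
- move=> n w _; have [->|n0] := posnP n.
    by rewrite mul0r normr0 mulr_ge0 ?sqr_ge0.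
  have r0 := @sqrtn_gt0 R n n0; have r2 := sqr_sqrtn R n.
  move: r0 r2; set r := Num.sqrt n%:R => r0 r2; rewrite -r2.
  have -> : s ^+ 2 * W w ^+ 2 = r ^+ 2 * ((s / r * W w) ^+ 2).
    by field; rewrite gt_eqF.
  by rewrite normrM ger0_norm ?sqr_ge0// ler_wpM2l ?sqr_ge0// sin_sub_id_le2.
Qed.

(** The factor e^(- a), with a = s^2 tau^2 / 2, is the n-th power of
    e^(- a / n); by [normc_subX] it suffices that n times the distance of the
    bases tends to 0, which is a statement on expectations, settled by
    dominated convergence with dominating function a multiple of W^2. *)
Lemma charf_power_cvg s :
  normc (charf P W (s / Num.sqrt n%:R) ^+ n
    - Complex (expR (- (s ^+ 2 * tau ^+ 2 / 2))) 0) @[n --> \oo] --> 0.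
Proof.
set a := s ^+ 2 * tau ^+ 2 / 2.
have a0 : 0 <= a by rewrite /a divr_ge0// mulr_ge0// sqr_ge0.
apply: (@squeeze_cvgr _ _ _ _ (cst 0) (fun n =>
  `|n%:R * (1 - complex.Re (charf P W (s / Num.sqrt n%:R)))
    - n%:R * (1 - expR (- (a / n%:R)))| +
  `|n%:R * complex.Im (charf P W (s / Num.sqrt n%:R))|)); first last.
- rewrite -[X in _ --> X]addr0; apply: cvgD.
    rewrite -[X in _ --> X](normr0 R) -(subrr a); apply: cvg_norm.
    by apply: cvgB; [exact: cvg_Re_charf|exact: cvg_expRn].
  by rewrite -[X in _ --> X](normr0 R); apply: cvg_norm; exact: cvg_Im_charf.
- exact: cvg_cst.
near=> n.
have n0 : (0 < n)%N by near: n; exists 1%N.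
have n1 : n%:R != 0 :> R by rewrite pnatr_eq0 -lt0n.
rewrite normc_ge0/=.
have -> : Complex (expR (- a)) 0 = Complex (expR (- (a / n%:R))) 0 ^+ n.
  have cX (x : R) : Complex (x ^+ n) 0 = Complex x 0 ^+ n :> complex R.
    exact: (rmorphXn (real_complex R) n x).
  by rewrite -cX -expRM_natl; congr (Complex (expR _) 0); field.
rewrite (le_trans (normc_subX _ _ _))//.
- exact: normc_charf_le1.
- by rewrite normc_real ger0_norm ?expR_ge0// expR_le1 oppr_le0 divr_ge0.
set z := charf _ _ _.
have -> : z - Complex (expR (- (a / n%:R))) 0 =
    Complex (complex.Re z - expR (- (a / n%:R))) (complex.Im z).
  by case: z => p q; apply/eqP; rewrite eq_complex/= subr0 !eqxx.
rewrite (le_trans (ler_wpM2l _ (normc_le_add _ _)))// mulrDr lerD//; last first.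
  by rewrite normrM ger0_norm.
rewrite -mulrBr normrM ger0_norm//.
have -> : 1 - complex.Re z - (1 - expR (- (a / n%:R))) =
    - (complex.Re z - expR (- (a / n%:R))) by ring.
by rewrite normrN.
Unshelve. all: by end_near. Qed.

End taylor.

(** * Fourier transform of the Gaussian *)

Section gaussian.
Context (R : realType).
Notation leb := (@lebesgue_measure R).

Lemma continuous_mulR (f g : R -> R) : continuous f -> continuous g ->
  continuous (fun x => f x * g x).
Proof. by move=> cf cg x; apply: continuousM; [exact: cf|exact: cg]. Qed.

Lemma continuous_subR (f g : R -> R) : continuous f -> continuous g ->
  continuous (fun x => f x - g x).
Proof. by move=> cf cg x; apply: continuousB; [exact: cf|exact: cg]. Qed.

Lemma continuous_idR : continuous (fun x : R => x).
Proof. by move=> x; exact: cvg_id. Qed.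

Lemma Rintegral_FTC (F f : R -> R) (a b : R) : a < b ->
  (forall x : R, is_derive x 1 F (f x)) -> continuous f ->
  \int[leb]_(x in `[a, b]) f x = F b - F a.
Proof.
move=> ab dF cf.
have cF : continuous F.
  by move=> x; apply: differentiable_continuous; apply/derivable1_diffP; have [] := dF x.
rewrite /Rintegral (@continuous_FTC2 _ f F)//.
- exact: continuous_subspaceT.
- split.
  + by move=> x _; have [] := dF x.
  + by apply: cvg_at_right_filter; exact: cF.
  + by apply: cvg_at_left_filter; exact: cF.
- by move=> x _; rewrite derive1E; have [] := dF x.
Qed.

(** The fundamental theorem of calculus on [-n, n], and dominated
    convergence as n tends to infinity. *)
Lemma Rintegral_derivative0 (F f : R -> R) :
  (forall x : R, is_derive x 1 F (f x)) -> continuous f ->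
  leb.-integrable setT (EFin \o f) ->
  F n%:R @[n --> \oo] --> 0 -> F (- n%:R) @[n --> \oo] --> 0 ->
  \int[leb]_x f x = 0.
Proof.
move=> dF cf fi Fp Fm.
have mf : measurable_fun setT f by exact: continuous_measurable_fun.
pose I (n : nat) : set R := `[(- n%:R), n%:R]%classic.
have H1 : \int[leb]_x (f \_ (I n)) x @[n --> \oo] --> \int[leb]_x f x.
  apply: (@Rintegral_dominated_cvg _ _ _ leb setT (fun n => f \_ (I n)) f (fun x => `|f x|)) => //.
  - move=> n; apply: (measurable_restrictT f (measurable_itv _)).1; exact: (measurable_funS measurableT (@subsetT _ _) mf).
  - move=> x _; apply: cvg_near_cst; near=> n.
    rewrite patchE mem_set//; rewrite /I/= in_itv/= -ler_norml.
    by near: n; exact: nbhs_infty_ger.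
  - exact: integrable_abse fi.
  - by move=> n x _; rewrite patchE; case: ifPn => // _; rewrite normr0.
have H2 : \int[leb]_x (f \_ (I n)) x @[n --> \oo] --> (0 : R).
  have H3 : F n%:R - F (- n%:R) @[n --> \oo] --> (0 - 0 : R) by exact: cvgB.
  rewrite subrr in H3; apply: cvg_trans H3.
  apply: near_eq_cvg; near=> n.
  rewrite -Rintegral_mkcond (Rintegral_FTC (F := F))//.
  by rewrite gtrN// ltr0n; near: n; exists 1%N.
exact: (cvg_unique _ H1 H2).
Unshelve. all: by end_near. Qed.

Definition gaussian (b x : R) := expR (- (b * x ^+ 2)).

Lemma gaussian_ge0 b x : 0 <= gaussian b x. Proof. exact: expR_ge0. Qed.

Lemma continuous_gaussian b : continuous (gaussian b).
Proof.
move=> x; apply: continuous_comp; last exact: continuous_expR.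
apply: continuousN; apply: continuousM; first exact: cst_continuous.
exact: exprn_continuous.
Qed.

Lemma gaussian_normal b : 0 < b ->
  gaussian b = (fun x => Num.sqrt (pi / b) * normal_pdf 0 (Num.sqrt (2 * b))^-1 x).
Proof.
move=> b0; set s := (Num.sqrt (2 * b))^-1.
have s0 : 0 < s by rewrite invr_gt0 sqrtr_gt0 mulr_gt0.
have s2 : s ^+ 2 = (2 * b)^-1 by rewrite /s exprVn sqr_sqrtr// mulr_ge0// ltW.
apply/funext => x; rewrite normal_pdfE ?gt_eqF// /normal_peak /normal_fun s2.
have -> : (2 * b)^-1 * pi *+ 2 = pi / b :> R by rewrite -mulr_natr; field; rewrite gt_eqF.
rewrite mulVKf; last by rewrite gt_eqF// sqrtr_gt0 divr_gt0// pi_gt0.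
by rewrite /gaussian; congr expR; rewrite subr0 -mulr_natr; field; rewrite gt_eqF.
Qed.

Lemma integrable_gaussian b : 0 < b -> leb.-integrable setT (EFin \o gaussian b).
Proof.
move=> b0; rewrite gaussian_normal//; apply: integrableZlR => //.
exact: integrable_normal_pdf.
Qed.

Lemma Rintegral_gaussian b : 0 < b -> \int[leb]_x gaussian b x = Num.sqrt (pi / b).
Proof.
move=> b0; rewrite gaussian_normal// RintegralZl//; last exact: integrable_normal_pdf.
by rewrite /Rintegral integral_normal_pdf mulr1.
Qed.

Lemma abs_gaussian_le b x : 0 < b ->
  `|x| * gaussian b x <= (1 + 2 / b) * gaussian (b / 2) x.
Proof.
move=> b0.
have -> : gaussian b x = gaussian (b / 2) x * gaussian (b / 2) x.
  by rewrite /gaussian -expRD; congr expR; field.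
rewrite mulrA ler_wpM2r ?gaussian_ge0// /gaussian expRN ler_pdivrMr ?expR_gt0//.
have b20 : 0 < 2 / b by rewrite divr_gt0.
apply: (@le_trans _ _ ((1 + 2 / b) * (1 + b / 2 * x ^+ 2))).
  have -> : (1 + 2 / b) * (1 + b / 2 * x ^+ 2) = 1 + x ^+ 2 + 2 / b + b / 2 * x ^+ 2.
    by field; rewrite gt_eqF.
  have : 0 <= b / 2 * x ^+ 2 by rewrite mulr_ge0 ?sqr_ge0// divr_ge0// ltW.
  have := sqr_ge0 (`|x| - 1); rewrite -[x ^+ 2]real_normK ?num_real//.
  have := normr_ge0 x; nra.
by rewrite ler_wpM2l ?expR_ge1Dx// addr_ge0// ltW.
Qed.

Lemma integrable_abs_gaussian b : 0 < b ->
  leb.-integrable setT (EFin \o (fun x => `|x| * gaussian b x)).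
Proof.
move=> b0.
have : leb.-integrable setT (EFin \o (fun x => (1 + 2 / b) * gaussian (b / 2) x)).
  by apply: integrableZlR => //; apply: integrable_gaussian; rewrite divr_gt0.
apply: le_integrable => //.
  apply/measurable_EFinP; apply: continuous_measurable_fun => x.
  apply: continuousM; first exact: norm_continuous.
  exact: continuous_gaussian.
move=> x _; rewrite lee_fin ger0_norm; last by rewrite mulr_ge0// gaussian_ge0.
by rewrite (le_trans (abs_gaussian_le x b0))// ler_norm.
Qed.


Section fourier.
Variable b : R.
Hypothesis b0 : 0 < b.

Let F k := \int[leb]_x (gaussian b x * cos (k * x)).

Lemma continuous_cos_mul k : continuous (fun x : R => cos (k * x)).
Proof.
move=> x; apply: continuous_comp; last exact: continuous_cos.
by apply: continuousM; [exact: cst_continuous|exact: cvg_id].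
Qed.

Lemma continuous_sin_mul k : continuous (fun x : R => sin (k * x)).
Proof.
move=> x; apply: continuous_comp; last exact: continuous_sin.
by apply: continuousM; [exact: cst_continuous|exact: cvg_id].
Qed.

Lemma integrable_dominated (f g : R -> R) : continuous f ->
  leb.-integrable setT (EFin \o g) -> (forall x, `|f x| <= g x) ->
  leb.-integrable setT (EFin \o f).
Proof.
move=> cf gi fg; apply: le_integrable gi => //.
  by apply/measurable_EFinP; exact: continuous_measurable_fun.
by move=> x _; rewrite lee_fin (le_trans (fg x))// ler_norm.
Qed.

Lemma integrable_gaussian_cos k :
  leb.-integrable setT (EFin \o (fun x => gaussian b x * cos (k * x))).
Proof.
apply: (integrable_dominated _ (integrable_gaussian b0)).
  by apply: continuous_mulR; [exact: continuous_gaussian|exact: continuous_cos_mul].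
move=> x; rewrite normrM ger0_norm ?gaussian_ge0// ler_piMr ?gaussian_ge0//.
exact: cos_max.
Qed.

Lemma integrable_gaussian_sin k :
  leb.-integrable setT (EFin \o (fun x => x * gaussian b x * sin (k * x))).
Proof.
apply: (integrable_dominated _ (integrable_abs_gaussian b0)).
  apply: continuous_mulR; last exact: continuous_sin_mul.
  by apply: continuous_mulR; [exact: continuous_idR|exact: continuous_gaussian].
move=> x; rewrite !normrM (@ger0_norm _ (gaussian _ _)) ?gaussian_ge0//.
by rewrite ler_piMr ?mulr_ge0 ?gaussian_ge0// sin_max.
Qed.

Lemma gaussian_cvg0 (s : R) : `|s| = 1 -> gaussian b (s * n%:R) @[n --> \oo] --> 0.
Proof.
move=> s1.
have s2 : s ^+ 2 = 1 by rewrite -real_normK ?num_real// s1 expr1n.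
have b1 : b != 0 by rewrite gt_eqF.
apply: (@cvg_dist_le _ _ (fun n => b^-1 * n%:R^-1)).
  move=> n n0; rewrite subr0 ger0_norm ?gaussian_ge0// /gaussian expRN.
  rewrite -invfM lef_pV2 ?posrE ?expR_gt0 ?mulr_gt0 ?ltr0n//.
  apply: le_trans (expR_ge1Dx _).
  rewrite exprMn s2 mul1r.
  have : b * n%:R <= b * n%:R ^+ 2.
    by rewrite ler_pM2l// expr2 ler_peMr// ler1n.
  lra.
by apply: cvgMl0; exact: cvg_invn.
Qed.

(** The integrand of the difference of both sides is the derivative of
    x |-> gaussian b x sin (k x), which vanishes at infinity. *)
Lemma gaussian_by_parts k :
  2 * b * \int[leb]_x (x * gaussian b x * sin (k * x)) = k * F k.
Proof.
pose f (x : R) := k * (gaussian b x * cos (k * x))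
  - 2 * b * (x * gaussian b x * sin (k * x)).
suff : \int[leb]_x f x = 0.
  rewrite RintegralB//.
  - rewrite RintegralZl//; last exact: integrable_gaussian_cos.
    rewrite RintegralZl//; last exact: integrable_gaussian_sin.
    by move/eqP; rewrite subr_eq0 => /eqP.
  - by apply: integrableZlR => //; exact: integrable_gaussian_cos.
  - by apply: integrableZlR => //; exact: integrable_gaussian_sin.
apply: (@Rintegral_derivative0 (fun x => gaussian b x * sin (k * x))).
- move=> x; rewrite /gaussian; apply: is_derive_eq.
  rewrite /f /gaussian /GRing.scale/=; ring.
- apply: continuous_subR.
    apply: continuous_mulR; first by move=> x; exact: cst_continuous.
    by apply: continuous_mulR; [exact: continuous_gaussian|exact: continuous_cos_mul].
  apply: continuous_mulR; first by move=> x; exact: cst_continuous.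
  apply: continuous_mulR; last exact: continuous_sin_mul.
  by apply: continuous_mulR; [exact: continuous_idR|exact: continuous_gaussian].
- apply: integrableBR => //.
  - by apply: integrableZlR => //; exact: integrable_gaussian_cos.
  - by apply: integrableZlR => //; exact: integrable_gaussian_sin.
- apply: (@cvg_dist_le _ _ (fun n => gaussian b (1 * n%:R))).
    move=> n _; rewrite subr0 normrM mul1r ger0_norm ?gaussian_ge0//.
    by rewrite ler_piMr ?gaussian_ge0// sin_max.
  by apply: gaussian_cvg0; rewrite normr1.
- apply: (@cvg_dist_le _ _ (fun n => gaussian b (-1 * n%:R))).
    move=> n _; rewrite subr0 normrM mulN1r ger0_norm ?gaussian_ge0//.
    by rewrite ler_piMr ?gaussian_ge0// sin_max.
  by apply: gaussian_cvg0; rewrite normrN1.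
Qed.

(** Differentiation under the integral sign, followed by
    [gaussian_by_parts], gives a linear differential equation for the transform. *)
Lemma is_derive_gaussian_fourier (k : R) : is_derive k (1 : R) F (- (k / (2 * b)) * F k).
Proof.
pose f (k x : R) := gaussian b x * cos (k * x).
have df (k' x : R) : is_derive k' 1 (f ^~ x) (- (x * gaussian b x * sin (k' * x))).
  rewrite /f; apply: is_derive_eq; rewrite /GRing.scale/=; ring.
have d1 k' x : partial1of2 f k' x = - (x * gaussian b x * sin (k' * x)).
  by rewrite partial1of2E; have [] := df k' x.
have Ik : (`]k - 1, k + 1[%classic : set R) k.
  by rewrite /= in_itv/= ltrBlDr ltrDl ltr01.
have i1 x : (`]k - 1, k + 1[%classic : set R) x -> leb.-integrable setT (EFin \o f x).
  by move=> _; exact: integrable_gaussian_cos.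
have i2 k' x : (`]k - 1, k + 1[%classic : set R) k' -> setT x -> derivable (f ^~ x) k' 1.
  by move=> _ _; have [] := df k' x.
have i3 x : 0 <= `|x| * gaussian b x by rewrite mulr_ge0// gaussian_ge0.
have i4 k' x : (`]k - 1, k + 1[%classic : set R) k' -> setT x ->
    `|partial1of2 f k' x| <= `|x| * gaussian b x.
  move=> _ _; rewrite d1 normrN !normrM (@ger0_norm _ (gaussian _ _)) ?gaussian_ge0//.
  by rewrite ler_piMr// sin_max.
apply: DeriveDef.
  exact: (derivable_under_integral measurableT Ik i1 i2 i3 (integrable_abs_gaussian b0) i4).
rewrite -derive1E.
rewrite (differentiation_under_integral measurableT Ik i1 i2 i3 (integrable_abs_gaussian b0) i4).
under eq_Rintegral do rewrite d1 -mulN1r.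
rewrite RintegralZl//; last exact: integrable_gaussian_sin.
have b1 : b != 0 by rewrite gt_eqF.
have -> : - (k / (2 * b)) * F k = - ((2 * b)^-1 * (k * F k)) by field.
by rewrite -gaussian_by_parts; field.
Qed.

(** The quotient of the transform by e^(- k^2 / (4 b)) has derivative 0
    by [is_derive_gaussian_fourier]; its value at 0 is the Gaussian integral. *)
Lemma gaussian_fourier k :
  \int[leb]_x (gaussian b x * cos (k * x)) =
  Num.sqrt (pi / b) * expR (- (k ^+ 2 / (4 * b))).
Proof.
have b1 : b != 0 by rewrite gt_eqF.
pose G (k : R) := F k * expR (k ^+ 2 / (4 * b)).
have dG (x : R) : is_derive x 1 G 0.
  have dF := is_derive_gaussian_fourier x.
  by rewrite /G; apply: is_derive_eq; rewrite /GRing.scale/=; field.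
have G0 : G k = G 0.
  exact: (@is_derive_0_is_cst _ G k 0 dG).
have : G 0 = Num.sqrt (pi / b).
  rewrite /G expr0n/= mul0r expR0 mulr1 /F -Rintegral_gaussian//.
  by apply: eq_Rintegral => x _; rewrite mul0r cos0 mulr1.
rewrite -G0 /G => <-.
by rewrite -mulrA -expRD subrr expR0 mulr1.
Qed.

End fourier.

End gaussian.

(** * Fourier inversion for integer-valued variables *)

Section inversion.
Context (R : realType) (d : measure_display) (T : measurableType d)
  (P : probability T R).
Notation leb := (@lebesgue_measure R).

Lemma sin_pi_int (k : int) : sin (pi * k%:~R) = 0 :> R.
Proof.
have sn (n : nat) : sin (pi * n%:R) = 0 :> R.
  elim: n => [|n IH]; first by rewrite mulr0 sin0.
  by rewrite -natr1 mulrDr mulr1 sinDpi IH oppr0.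
case: k => n; first exact: sn.
by rewrite NegzE rmorphN/= mulrN sinN sn oppr0.
Qed.

Lemma Rintegral_cos_int (r : R) (k : int) : 0 < r ->
  \int[leb]_(u in `[- (pi * r), pi * r]) cos (u / r * k%:~R) =
  2 * pi * r * (k == 0)%:R.
Proof.
move=> r0; have r1 : r != 0 by rewrite gt_eqF.
have pr0 : 0 < pi * r by rewrite mulr_gt0// pi_gt0.
have ab : - (pi * r) < pi * r by rewrite gtrN.
have [->|k0] := eqVneq k 0.
  under eq_Rintegral do rewrite mulr0 cos0.
  rewrite (Rintegral_FTC (F := id) (f := cst 1) ab) ?mulr1; first by rewrite /=; ring.
  - by move=> x; exact: cst_continuous.
have k1 : k%:~R != 0 :> R by rewrite intr_eq0.
have dF (x : R) : is_derive x (1 : R) (fun u => r / k%:~R * sin (k%:~R / r * u))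
    (cos (x / r * k%:~R)).
  apply: is_derive_eq; rewrite /GRing.scale/=.
  have -> : k%:~R / r * x = x / r * k%:~R by field.
  by field; rewrite r1 k1.
have cf : continuous (fun u : R => cos (u / r * k%:~R)).
  have -> : (fun u : R => cos (u / r * k%:~R)) = (fun u => cos (k%:~R / r * u)).
    by apply/funext => u; congr cos; field.
  exact: continuous_cos_mul.
rewrite (Rintegral_FTC ab dF cf).
have -> : k%:~R / r * (pi * r) = pi * k%:~R by field.
have -> : k%:~R / r * (- (pi * r)) = - (pi * k%:~R) by field.
by rewrite sinN sin_pi_int oppr0 !mulr0 subrr.
Qed.

Lemma continuous_Re_charf (f : T -> R) : measurable_fun setT f ->
  continuous (fun t => complex.Re (charf P f t)).
Proof.
move=> mf t; rewrite /=.
have i1 x : (`]t - 1, t + 1[%classic : set R) x ->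
    P.-integrable setT (EFin \o (fun w => cos (x * f w))).
  by move=> _; exact: integrable_cos_mul.
have := @continuity_under_integral R _ T P (fun x w => cos (x * f w)) setT
  measurableT (t - 1) (t + 1) i1 _ (cst 1) _ _.
apply.
- apply: aeW => w _ x _.
  apply: continuous_comp; last exact: continuous_cos.
  by apply: continuousM; [exact: cvg_id|exact: cst_continuous].
- by apply: (@prob_bounded_integrable _ _ _ P _ 1) => // x; rewrite normr1.
- by move=> x _; apply: aeW => w _; exact: cos_max.
- by rewrite inE/= in_itv/= ltrBlDr ltrDl ltr01.
Qed.

Lemma continuous_Im_charf (f : T -> R) : measurable_fun setT f ->
  continuous (fun t => complex.Im (charf P f t)).
Proof.
move=> mf t; rewrite /=.
have i1 x : (`]t - 1, t + 1[%classic : set R) x ->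
    P.-integrable setT (EFin \o (fun w => sin (x * f w))).
  by move=> _; exact: integrable_sin_mul.
have := @continuity_under_integral R _ T P (fun x w => sin (x * f w)) setT
  measurableT (t - 1) (t + 1) i1 _ (cst 1) _ _.
apply.
- apply: aeW => w _ x _.
  apply: continuous_comp; last exact: continuous_sin.
  by apply: continuousM; [exact: cvg_id|exact: cst_continuous].
- by apply: (@prob_bounded_integrable _ _ _ P _ 1) => // x; rewrite normr1.
- by move=> x _; apply: aeW => w _; exact: sin_max.
- by rewrite inE/= in_itv/= ltrBlDr ltrDl ltr01.
Qed.

Lemma ae_prob1 (B : set T) : measurable B -> P B = 1%E -> {ae P, forall w, B w}.
Proof.
move=> mB PB; exists (~` B); split => //; first exact: measurableC.
by rewrite probability_setC// PB subee.
Qed.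

(** By Fubini's theorem the right-hand side is the expectation of the mean
    of cos (u Z / r) over the interval, which is 1 if Z = 0 and, Z being an
    integer, 0 otherwise.  The scale r spares every later change of variables. *)
Lemma prob_inversion (Z : T -> R) (r : R) : measurable_fun setT Z -> 0 < r ->
  P (Z @^-1` lattice 0 1) = 1%E ->
  fine (P (Z @^-1` [set 0])) = (2 * pi * r)^-1 *
    \int[leb]_(u in `[- (pi * r), pi * r]) complex.Re (charf P Z (u / r)).
Proof.
move=> mZ r0 PZ.
set A : set R := `[_, _]%classic.
have mA : measurable A by exact: measurable_itv.
have lebA : (leb A < +oo)%E.
  by rewrite /A lebesgue_measure_itv/=; case: ifP => _; rewrite ?ltry// -EFinB ltry.
have pr0 : 0 < 2 * pi * r by rewrite !mulr_gt0// pi_gt0.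
pose f (z : R * T) : R := \1_A z.1 * cos (z.1 / r * Z z.2).
have mf : measurable_fun setT f.
  apply: measurable_funM; first by apply: measurableT_comp => //; exact: measurable_indic.
  apply: measurableT_comp.
    by apply: continuous_measurable_fun; exact: continuous_cos.
  apply: measurable_funM; last exact: measurableT_comp.
  by apply: measurable_funM => //; exact: measurable_fst.
have mf1 u : measurable_fun setT (fun w => f (u, w)).
  by rewrite /f /=; apply: measurable_funM => //; exact: measurable_cos_mul.
have fA u w : `|f (u, w)| <= \1_A u.
  by rewrite normrM ger0_norm ?ler_piMr ?cos_max// indicE.
have mZ0 : measurable (Z @^-1` [set 0]).
  by rewrite -[X in measurable X]setTI; exact: mZ.
have if_ : (leb \x P)%E.-integrable setT (EFin \o f).
  apply/integrable12ltyP; first exact/measurable_EFinP.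
  apply: (@le_lt_trans _ _ (\int[leb]_u (\1_A u)%:E)%E); last first.
    by rewrite integral_indic// setIT.
  apply: ge0_le_integral => //.
  - by move=> u _; apply: integral_ge0 => w _.
  - have mfE : measurable_fun setT (fun z => `|(EFin \o f) z|%E).
      by apply: measurableT_comp => //; exact/measurable_EFinP.
    exact: (measurable_fun_fubini_tonelli_F _ mfE).
  - by apply/measurable_EFinP; exact: measurable_indic.
  - move=> u _.
    apply: (@le_trans _ _ (\int[P]_w (cst (\1_A u)%:E w))%E); last first.
      by rewrite integral_cst// -[X in (_ * X)%E]/(P setT) probability_setT mule1.
    apply: ge0_le_integral => //.
    + by apply/measurable_EFinP; exact: measurableT_comp.
    + by move=> w _; rewrite lee_fin fA.
have PE (g : T -> R) : P.-integrable setT (EFin \o g) ->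
    (\int[P]_w (g w)%:E = (\int[P]_w g w)%R%:E)%E.
  by move=> gi; rewrite /Rintegral fineK//; exact: integrable_fin_num.
have := Fubini if_.
rewrite [X in X = _](_ : _ = (\int[leb]_(u in A) (complex.Re (charf P Z (u / r)))%:E)%E); last first.
  rewrite [RHS]integral_mkcond; apply: eq_integral => u _.
  rewrite /= PE; last first.
    by apply: (@prob_bounded_integrable _ _ _ P _ 1) => // w; rewrite (le_trans (fA u w))// indicE lern1 leq_b1.
  rewrite /f /= RintegralZl//; last exact: integrable_cos_mul.
  by rewrite patchE indicE; case: ifPn => _; rewrite ?mul1r ?mul0r.
rewrite [X in _ = X](_ : _ = (\int[P]_w ((2 * pi * r) * \1_(Z @^-1` [set 0]) w)%:E)%E); last first.
  apply: ae_eq_integral => //.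
  - by apply: measurable_fubini_G; exact: if_.
  - apply/measurable_EFinP; apply: measurable_funM => //; exact: measurable_indic.
  have Zae : {ae P, forall w, (Z @^-1` lattice 0 1) w}.
    apply: ae_prob1 => //; rewrite -[X in measurable X]setTI; apply: mZ => //.
    exact: measurable_lattice.
  apply: filterS Zae => w [k _]; rewrite add0r mul1r => kZ _.
  transitivity (\int[leb]_(u in A) (cos (u / r * k%:~R))%:E)%E.
    rewrite [RHS]integral_mkcond; apply: eq_integral => u _.
    by rewrite /f /= patchE indicE -kZ; case: ifPn => _; rewrite ?mul1r ?mul0r.
  have -> : \1_(Z @^-1` [set 0]) w = (k == 0)%:R :> R.
    rewrite indicE; congr (_ %:R); congr nat_of_bool.
    apply/idP/eqP => [/set_mem|k0]; first by rewrite /preimage/= -kZ => /eqP; rewrite intr_eq0 => /eqP.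
    by apply: mem_set; rewrite /preimage/= -kZ k0.
  rewrite -Rintegral_cos_int// /Rintegral fineK//.
  apply: integrable_fin_num => //; apply: (@bounded_integrable _ _ _ _ _ _ 1) => //.
    apply: measurable_funTS; apply: continuous_measurable_fun => u.
    apply: continuous_comp; last exact: continuous_cos.
    by do 2 (apply: continuousM; last exact: cst_continuous); exact: cvg_id.
  by move=> u _; exact: cos_max.
have iI : P.-integrable setT (EFin \o \1_(Z @^-1` [set 0])).
  apply: (@prob_bounded_integrable _ _ _ P _ 1); first exact: measurable_indic.
  by move=> w; rewrite indicE; case: (_ \in _); rewrite ?normr1 ?normr0.
rewrite PE; last exact: integrableZlR.
rewrite RintegralZl// [X in _ = (_ * X)%:E -> _]/Rintegral integral_indic// setIT => E.
by rewrite /Rintegral E /= mulKf// gt_eqF.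
Qed.

End inversion.

(** * Point probabilities of blocks *)

Section charf_rules.
Context (R : realType) (d : measure_display) (T : measurableType d)
  (P : probability T R).

Lemma charf_affine (f : T -> R) (c D t : R) : measurable_fun setT f ->
  charf P (fun w => (f w - c) / D) t = cis (- (t * c / D)) * charf P f (t / D).
Proof.
move=> mf; rewrite /cis cosN sinN.
set a := t * c / D.
have E w : t * ((f w - c) / D) = t / D * f w - a by rewrite /a; ring.
apply/eqP; rewrite eq_complex/=; apply/andP; split; apply/eqP.
  rewrite mulNr opprK -[RHS](charf_proj P (t / D) (cos a) (sin a) mf).
  by apply: eq_Rintegral => w _; rewrite E cosB; ring.
rewrite [RHS]addrC -[RHS](charf_proj P (t / D) (- sin a) (cos a) mf).
by apply: eq_Rintegral => w _; rewrite E sinB; ring.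
Qed.

Lemma charf_add (U V : {RV P >-> R}) t :
  (forall A B, measurable A -> measurable B ->
     P (U @^-1` A `&` V @^-1` B) = (P (U @^-1` A) * P (V @^-1` B))%E) ->
  charf P (fun w => U w + V w) t = charf P U t * charf P V t.
Proof.
move=> ind.
have mc : measurable_fun setT (fun x : R => cos (t * x)) by exact: measurable_cos_mul.
have ms : measurable_fun setT (fun x : R => sin (t * x)) by exact: measurable_sin_mul.
have bc (x : R) : `|cos (t * x)| <= 1 by exact: cos_max.
have bs (x : R) : `|sin (t * x)| <= 1 by exact: sin_max.
have bnd (f g : R -> R) : measurable_fun setT f -> measurable_fun setT g ->
    (forall x, `|f x| <= 1) -> (forall x, `|g x| <= 1) ->
    P.-integrable setT (EFin \o (fun w => f (U w) * g (V w))).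
  move=> mf mg bf bg; apply: (@prob_bounded_integrable _ _ _ P _ 1).
    have mfU : measurable_fun setT (f \o U) by exact: measurableT_comp.
    have mgV : measurable_fun setT (g \o V) by exact: measurableT_comp.
    exact: measurable_funM mfU mgV.
  by move=> w; rewrite normrM mulr_ile1.
have H f g mf mg bf bg := @Rintegral_mul_indep _ _ _ P U V f g 1 ind mf mg bf bg.
apply/eqP; rewrite eq_complex/=; apply/andP; split; apply/eqP.
  rewrite -(H _ _ mc mc bc bc) -(H _ _ ms ms bs bs) -RintegralB//; [|exact: (bnd _ _ mc mc bc bc)|exact: (bnd _ _ ms ms bs bs)].
  by apply: eq_Rintegral => w _; rewrite mulrDr cosD.
rewrite -(H _ _ mc ms bc bs) -(H _ _ ms mc bs bc) -RintegralD//; [|exact: (bnd _ _ mc ms bc bs)|exact: (bnd _ _ ms mc bs bc)].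
by apply: eq_Rintegral => w _; rewrite mulrDr sinD addrC.
Qed.

End charf_rules.

Section law.
Context (R : realType) (d d' : measure_display) (T : measurableType d)
  (T' : measurableType d') (P : probability T R) (P' : probability T' R)
  (X : {RV P >-> R}) (Y : {RV P' >-> R}).

Lemma charf_same_law t : same_law X Y -> charf P X t = charf P' Y t.
Proof.
move=> XY.
have mc : measurable_fun setT (fun x : R => cos (t * x)) by exact: measurable_cos_mul.
have ms : measurable_fun setT (fun x : R => sin (t * x)) by exact: measurable_sin_mul.
have tr (f : R -> R) : measurable_fun setT f -> (forall x, `|f x| <= 1) ->
    \int[P]_w f (X w) = \int[P']_w f (Y w).
  move=> mf bf; rewrite /Rintegral.
  have iX : P.-integrable setT ((EFin \o f) \o X).
    by apply: (@prob_bounded_integrable _ _ _ P (f \o X) 1); [exact: measurableT_comp|move=> w; exact: bf].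
  have iY : P'.-integrable setT ((EFin \o f) \o Y).
    by apply: (@prob_bounded_integrable _ _ _ P' (f \o Y) 1); [exact: measurableT_comp|move=> w; exact: bf].
  have mfE : measurable_fun setT (EFin \o f) by exact/measurable_EFinP.
  rewrite -[in LHS](integral_distribution mfE iX) -[in RHS](integral_distribution mfE iY).
  by congr fine; apply: eq_measure_integral => A mA _; exact: XY.
by rewrite /charf (tr (fun x => cos (t * x)))// ?(tr (fun x => sin (t * x)))// => x;
  [exact: sin_max|exact: cos_max].
Qed.

End law.

Section block_prob.
Context (R : realType) (d0 : measure_display) (T0 : measurableType d0)
  (P0 : probability T0 R) (X : {RV P0 >-> R}) (v0 D mu : R)
  (d : measure_display) (T : measurableType d) (P : probability T R)
  (X_ : nat -> {RV P >-> R}).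
Notation leb := (@lebesgue_measure R).
Hypotheses (D0 : 0 < D) (PL : P0 (X @^-1` lattice v0 D) = 1%E)
  (X_indep : mutually_independent X_)
  (X_copies : forall k, same_law (X_ k) X).

Lemma charf_block m n t : (m <= n)%N ->
  charf P (block X_ m n) t = charf P0 X t ^+ (n - m).
Proof.
elim: n => [|n IH].
  rewrite leqn0 => /eqP ->.
  rewrite (_ : (block X_ 0 0 : T -> R) = cst 0); last first.
    by apply/funext => w; rewrite blockE big_geq.
  rewrite subn0 expr0 /charf /= mulr0 cos0 sin0.
  by rewrite (Rintegral_cst1 P 0) (Rintegral_cst1 P 1).
rewrite leq_eqVlt => /predU1P[->|].
  rewrite (_ : (block X_ n.+1 n.+1 : T -> R) = cst 0); last first.
    by apply/funext => w; rewrite blockE big_geq.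
  rewrite subnn expr0 /charf /= mulr0 cos0 sin0.
  by rewrite (Rintegral_cst1 P 0) (Rintegral_cst1 P 1).
rewrite ltnS => mn.
rewrite (_ : (block X_ m n.+1 : T -> R) = fun w => block X_ m n w + X_ n w); last first.
  by apply/funext => w; rewrite !blockE big_nat_recr.
rewrite charf_add; last first.
  by move=> A B mA mB; exact: block_next_indep.
by rewrite IH// (charf_same_law t (X_copies n)) subSn// exprSr.
Qed.

Lemma block_lattice m n : (m <= n)%N ->
  P (block X_ m n @^-1` lattice ((n - m)%:R * v0) D) = 1%E.
Proof.
move=> mn.
have mX A k : measurable A -> measurable (X_ k @^-1` A) by exact: measurable_RV_preimage.
have Xk k : P (X_ k @^-1` lattice v0 D) = 1%E.
  by rewrite -PL; apply: X_copies; exact: measurable_lattice.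
have all1 : P (\bigcap_(k in [set` [fset k in iota m (n - m)]%fset]) (X_ k @^-1` lattice v0 D)) = 1%E.
  rewrite X_indep; last by move=> k _; exact: measurable_lattice.
  by rewrite big1.
have mB : measurable (block X_ m n @^-1` lattice ((n - m)%:R * v0) D).
  by apply: measurable_RV_preimage; exact: measurable_lattice.
apply/eqP; rewrite eq_le; apply/andP; split; first exact: probability_le1.
rewrite -all1; apply: le_measure; rewrite ?inE.
- apply: fin_bigcap_measurable => [|k _]; first exact: finite_fset.
  exact: (mX _ _ (measurable_lattice _ _)).
- exact: mB.
move=> w H.
have {}H k : (m <= k < n)%N -> lattice v0 D (X_ k w).
  by move=> mkn; apply: H; rewrite /= !inE mem_iota subnKC.
rewrite /preimage /=.
elim: n mn {all1 mB} H => [|n IH] mn H.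
  exists 0 => //; rewrite big_geq// sub0n; ring.
move: mn; rewrite leq_eqVlt => /predU1P[->|mn].
  by exists 0 => //; rewrite big_geq// subnn; ring.
have H' k : (m <= k < n)%N -> lattice v0 D (X_ k w).
  by move=> /andP[mk kn]; apply: H; rewrite mk ltnW.
have [k _ E] := IH mn H'.
have [|j _ E'] := H n; first by rewrite ltnSn andbT.
exists (k + j) => //.
by rewrite big_nat_recr//= -E -E' subSn// -natr1 rmorphD/=; ring.
Qed.

(** Fourier inversion for (block - s) / D, which is integer-valued.  The
    variable X enters centred and reduced, and s through its deviation x from
    the mean, measured in units of D. *)
Lemma block_prob m n x r s : (m <= n)%N -> 0 < r ->
  lattice ((n - m)%:R * v0) D s -> s = (n - m)%:R * mu + D * x ->
  fine (P (block X_ m n @^-1` [set s])) = (2 * pi * r)^-1 *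
    \int[leb]_(u in `[- (pi * r), pi * r])
      complex.Re (cis (- (u / r * x)) *
        charf P0 (fun w => (X w - mu) / D) (u / r) ^+ (n - m)).
Proof.
move=> mn r0 [j _ js] sx.
have D1 : D != 0 by rewrite gt_eqF.
have r1 : r != 0 by rewrite gt_eqF.
pose Z w := (block X_ m n w - s) / D.
have mZ : measurable_fun setT Z.
  by apply: measurable_funM => //; exact: measurable_funB.
have ZE (B : T -> R) : B @^-1` [set s] = (fun w => (B w - s) / D) @^-1` [set 0].
  apply/seteqP; split=> w; rewrite /preimage/=; first by move=> ->; rewrite subrr mul0r.
  by move/eqP; rewrite mulf_eq0 invr_eq0 (negbTE D1) orbF subr_eq0 => /eqP.
have ZL (B : T -> R) : (fun w => (B w - s) / D) @^-1` lattice 0 1 =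
    B @^-1` lattice ((n - m)%:R * v0) D.
  apply/seteqP; split=> w; rewrite /preimage/= => -[k _ kE].
    exists (k + j) => //; rewrite rmorphD/= mulrDr addrCA js.
    rewrite -[in RHS](subrK s (B w)); congr (_ + _).
    by move: kE; rewrite add0r mul1r => ->; field.
  by exists (k - j) => //; rewrite add0r mul1r -kE -js rmorphB/=; field.
have PZ : P (Z @^-1` lattice 0 1) = 1%E by rewrite /Z ZL (block_lattice mn).
rewrite ZE -/Z.
rewrite (prob_inversion mZ r0 PZ); congr (_ * _); apply: eq_Rintegral => u _.
congr complex.Re.
have mB : measurable_fun setT (block X_ m n) by [].
have mX : measurable_fun setT X by [].
rewrite (charf_affine P s D (u / r) mB) charf_block// (charf_affine P0 mu D (u / r) mX).
rewrite exprMn mulrA; congr (_ * _).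
have cisX (y : R) k : cis y ^+ k = cis (k%:R * y).
  elim: k => [|k IH]; first by rewrite expr0 mul0r cis0.
  by rewrite exprS IH -cisD -nat1r mulrDl mul1r.
by rewrite cisX -cisD sx; congr cis; field; rewrite D1.
Qed.

End block_prob.

(** * Local limit theorem and local estimates *)

Lemma Rintegral_le_nonneg (R : realType) (d : measure_display) (T : measurableType d)
    (m : {measure set T -> \bar R}) (A : set T) (f g : T -> R) : measurable A ->
  m.-integrable A (EFin \o f) -> m.-integrable setT (EFin \o g) ->
  (forall u, 0 <= g u) -> (forall u, A u -> `|f u| <= g u) ->
  `|\int[m]_(u in A) f u| <= \int[m]_u g u.
Proof.
move=> mA fi gi g0 fg.
rewrite (le_trans (le_normr_Rintegral mA fi))//.
rewrite Rintegral_mkcond; apply: le_Rintegral => //.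
  have := (integrable_mkcond _ mA).1 (integrable_abse fi).
  apply: eq_integrable => // u _.
  by rewrite /= !patchE; case: ifPn.
move=> u _; rewrite patchE; case: ifPn => // uA; apply: fg; exact: set_mem.
Qed.

Section local_limit.
Context (R : realType) (d : measure_display) (T : measurableType d)
  (P : probability T R) (W : T -> R) (tau c : R).
Notation leb := (@lebesgue_measure R).
Hypotheses (mW : measurable_fun setT W)
  (iW : P.-integrable setT (EFin \o W))
  (iW2 : P.-integrable setT (EFin \o (fun w => W w ^+ 2)))
  (EW : \int[P]_w W w = 0) (EW2 : \int[P]_w (W w ^+ 2) = tau ^+ 2)
  (tau0 : 0 < tau) (c0 : 0 < c)
  (psi_bound : forall t, `|t| <= pi -> normc (charf P W t) <= 1 - c * t ^+ 2).

Notation psi := (charf P W).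

(** Continuity is expressed through real and imaginary parts, which keeps
    the complex numbers purely algebraic. *)
Definition complex_continuous (f : R -> complex R) :=
  continuous (fun u => complex.Re (f u)) /\ continuous (fun u => complex.Im (f u)).

Lemma ccontM f g : complex_continuous f -> complex_continuous g -> complex_continuous (fun u => f u * g u).
Proof.
move=> [f1 f2] [g1 g2].
have E u : f u * g u = Complex
    (complex.Re (f u) * complex.Re (g u) - complex.Im (f u) * complex.Im (g u))
    (complex.Re (f u) * complex.Im (g u) + complex.Im (f u) * complex.Re (g u)).
  by case: (f u) => a1 a2; case: (g u) => b1 b2.
split.
  under eq_fun do rewrite E /=.
  by apply: continuous_subR; exact: continuous_mulR.
under eq_fun do rewrite E /=.
move=> u; apply: (@continuousD _ _ _ (fun u => complex.Re (f u) * complex.Im (g u))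
  (fun u => complex.Im (f u) * complex.Re (g u))); exact: continuous_mulR.
Qed.

Lemma ccontX f n : complex_continuous f -> complex_continuous (fun u => f u ^+ n).
Proof.
move=> cf; elim: n => [|n IH].
  by under [complex_continuous]/complex_continuous; split=> u; exact: cst_continuous.
rewrite (_ : (fun _ => _) = fun u => f u * f u ^+ n); last first.
  by apply/funext => u; rewrite exprS.
exact: ccontM.
Qed.

Definition fourier_integrand (r x : R) (k : nat) (u : R) : complex R :=
  cis (- (u / r * x)) * psi (u / r) ^+ k.

Lemma ccont_integrand r x k : complex_continuous (fourier_integrand r x k).
Proof.
have lin : continuous (fun u : R => u / r).
  by apply: continuous_mulR; [exact: continuous_idR|move=> u; exact: cst_continuous].
have cstR (a : R) : continuous (fun _ : R => a) by move=> u; exact: cst_continuous.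
have lin2 : continuous (fun u : R => - (u / r * x)).
  have := continuous_mulR (cstR (-1)) (continuous_mulR lin (cstR x)).
  by under eq_fun do rewrite mulN1r.
apply: ccontM.
  split => u; apply: (continuous_comp (lin2 u)).
    exact: continuous_cos.
  exact: continuous_sin.
apply: ccontX; split=> u.
  apply: (continuous_comp (g := fun t => complex.Re (psi t)) (lin u)).
  exact: continuous_Re_charf.
apply: (continuous_comp (g := fun t => complex.Im (psi t)) (lin u)).
exact: continuous_Im_charf.
Qed.

Definition fourier_itv (r : R) : set R := `[- (pi * r), pi * r]%classic.

(** The uniform Gaussian domination used in all three estimates below: it
    is the bound 1 - c t^2 <= e^(- c t^2) at t = u / sqrt k, raised to the
    power k. *)
Lemma psiX_gaussian k u : fourier_itv (Num.sqrt k%:R) u ->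
  normc (psi (u / Num.sqrt k%:R) ^+ k) <= gaussian c u.
Proof.
rewrite /fourier_itv/= in_itv/= -ler_norml.
have [->|k0] := posnP k.
  rewrite sqrtr0 mulr0 normr_le0 => /eqP ->.
  by rewrite expr0 normc1 /gaussian expr0n/= mulr0 oppr0 expR0.
have r0 := @sqrtn_gt0 R k k0; have r2 := sqr_sqrtn R k.
set r := Num.sqrt k%:R in r0 r2 *.
move=> ur; have tpi : `|u / r| <= pi.
  by rewrite normrM (@gtr0_norm _ r^-1) ?invr_gt0// ler_pdivrMr.
rewrite normcX /gaussian.
have -> : - (c * u ^+ 2) = k%:R * (- (c * (u / r) ^+ 2)).
  by rewrite -r2; field; rewrite gt_eqF.
rewrite expRM_natl lerXn2r ?nnegrE ?normc_ge0 ?expR_ge0//.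
exact: le_trans (psi_bound tpi) (expR_ge1Dx _).
Qed.

Lemma integrand_bound x k u : fourier_itv (Num.sqrt k%:R) u ->
  normc (fourier_integrand (Num.sqrt k%:R) x k u) <= gaussian c u.
Proof. by move=> Au; rewrite normcM normc_cis mul1r psiX_gaussian. Qed.

Lemma measurable_fourier_itv r : measurable (fourier_itv r).
Proof. exact: measurable_itv. Qed.

Lemma integrable_integrand r x k :
  leb.-integrable (fourier_itv r) (EFin \o (fun u => complex.Re (fourier_integrand r x k u))).
Proof.
apply: continuous_compact_integrable; first exact: segment_compact.
by apply: continuous_subspaceT; have [] := ccont_integrand r x k.
Qed.

(** For W = (X - mu) / D this is by [block_prob], whatever r > 0, the
    probability that a sum of k independent copies of X takes the lattice value
    k mu + D x. *)
Definition lattice_mass (r : R) (k : nat) (x : R) : R :=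
  (2 * pi * r)^-1 * \int[leb]_(u in fourier_itv r) complex.Re (fourier_integrand r x k u).

Lemma local_bound : exists C : R, 0 <= C /\ forall (k : nat) x, (0 < k)%N ->
  `|lattice_mass (Num.sqrt k%:R) k x| <= C / Num.sqrt k%:R.
Proof.
exists ((2 * pi)^-1 * \int[leb]_u gaussian c u).
have p0 : 0 < 2 * pi :> R by rewrite mulr_gt0// pi_gt0.
split.
  by rewrite mulr_ge0 ?invr_ge0 ?(ltW p0)//; apply: Rintegral_ge0 => u _; exact: gaussian_ge0.
move=> k x k0; have r0 := @sqrtn_gt0 R k k0.
rewrite /lattice_mass normrM invfM ger0_norm; last by rewrite mulr_ge0 ?invr_ge0 ?ltW.
rewrite mulrAC ler_wpM2r ?invr_ge0 ?(ltW r0)// ler_wpM2l ?invr_ge0 ?(ltW p0)//.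
apply: Rintegral_le_nonneg; first exact: measurable_fourier_itv.
- exact: integrable_integrand.
- exact: integrable_gaussian.
- exact: gaussian_ge0.
- by move=> u Au; rewrite (le_trans (normr_Re_le _))// integrand_bound.
Qed.

(** The left-hand side is at most 2 and, by [charf_quadratic], at most a^2
    where a = sqrt m sqrt (2 tau^2) |t|; in both cases it is at most 2 a. *)
Lemma one_sub_psiX m t :
  normc (1 - psi t ^+ m) <= 2 * (Num.sqrt m%:R * Num.sqrt (2 * tau ^+ 2) * `|t|).
Proof.
have n1 : normc (psi t) <= 1 by exact: normc_charf_le1.
set K := 2 * tau ^+ 2; have K0 : 0 <= K by rewrite mulr_ge0// sqr_ge0.
set a := _ * `|t|.
have a0 : 0 <= a by rewrite !mulr_ge0// sqrtr_ge0.
have a2 : a ^+ 2 = m%:R * (K * t ^+ 2).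
  by rewrite /a !exprMn !sqr_sqrtr// real_normK ?num_real// mulrA.
have b1 : normc (1 - psi t ^+ m) <= a ^+ 2.
  rewrite a2 -[X in normc (X - _)](expr1n _ m).
  rewrite (le_trans (normc_subX m _ n1)) ?normc1// ler_wpM2l//.
  exact: charf_quadratic.
have b2 : normc (1 - psi t ^+ m) <= 2.
  rewrite (le_trans (ler_normcD _ _))// normc1 normc_opp normcX.
  have : normc (psi t) ^+ m <= 1 by rewrite exprn_ile1// normc_ge0.
  lra.
(* If a <= 1 then a^2 <= 2 a, otherwise 2 <= 2 a. *)
have [a1|a1] := leP a 1; nra.
Qed.

(** The integrands differ by the factor 1 - e^(- i t z) psi(t)^m with
    t = u / sqrt k, whose modulus is O(|t| (|z| + sqrt m)).  The factor |t| gains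
    1 / sqrt k over [local_bound]. *)
Lemma local_increment : exists C : R, 0 <= C /\ forall (k m : nat) y z, (0 < k)%N ->
  `|lattice_mass (Num.sqrt k%:R) k y - lattice_mass (Num.sqrt k%:R) (k + m) (y + z)| <=
    C * (Num.sqrt m%:R + `|z|) / k%:R.
Proof.
set K := 2 * Num.sqrt (2 * tau ^+ 2); have K0 : 0 <= K by rewrite mulr_ge0// sqrtr_ge0.
pose M := \int[leb]_u (`|u| * gaussian c u).
have M0 : 0 <= M.
  by apply: Rintegral_ge0 => u _; rewrite mulr_ge0// gaussian_ge0.
have p0 : 0 < 2 * pi :> R by rewrite mulr_gt0// pi_gt0.
exists ((2 * pi)^-1 * M * (1 + K)); split.
  by rewrite !mulr_ge0 ?invr_ge0 ?(ltW p0)// addr_ge0.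
move=> k m y z k0; have r0 := @sqrtn_gt0 R k k0; have r2 := sqr_sqrtn R k.
set r := Num.sqrt k%:R in r0 r2 *.
have sm0 := sqrtr_ge0 (m%:R : R).
set L := Num.sqrt m%:R * K + `|z|; have L0 : 0 <= L by rewrite addr_ge0// mulr_ge0.
rewrite /lattice_mass -mulrBr -RintegralB; [|exact: measurable_fourier_itv|exact: integrable_integrand|exact: integrable_integrand].
have bnd u : fourier_itv r u ->
    `|complex.Re (fourier_integrand r y k u) - complex.Re (fourier_integrand r (y + z) (k + m) u)|
      <= L / r * (`|u| * gaussian c u).
  move=> Au; rewrite -raddfB.
  have -> : fourier_integrand r y k u - fourier_integrand r (y + z) (k + m) u =
      fourier_integrand r y k u * (1 - cis (- (u / r * z)) * psi (u / r) ^+ m).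
    rewrite /fourier_integrand mulrDr opprD cisD exprD; ring.
  rewrite (le_trans (normr_Re_le _))// normcM.
  have b1 : normc (1 - cis (- (u / r * z)) * psi (u / r) ^+ m) <= L / r * `|u|.
    have -> : 1 - cis (- (u / r * z)) * psi (u / r) ^+ m =
       (1 - psi (u / r) ^+ m) - (cis (- (u / r * z)) - 1) * psi (u / r) ^+ m by ring.
    rewrite (le_trans (ler_normcD _ _))// normc_opp normcM.
    have n1 : normc (psi (u / r) ^+ m) <= 1.
      by rewrite normcX exprn_ile1 ?normc_ge0//; exact: normc_charf_le1.
    have h1 := one_sub_psiX m (u / r).
    have h2 := normc_cis_sub1 (- (u / r * z)).
    have ur : `|u / r| = `|u| / r by rewrite normrM (@gtr0_norm _ r^-1) ?invr_gt0.
    rewrite normrN normrM ur in h2; rewrite ur in h1.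
    have -> : L / r * `|u| = 2 * (Num.sqrt m%:R * Num.sqrt (2 * tau ^+ 2) * (`|u| / r))
        + `|u| / r * `|z| by rewrite /L /K; ring.
    by apply: lerD => //; apply: le_trans h2; rewrite ler_piMr//; exact: normc_ge0.
  apply: (@le_trans _ _ (gaussian c u * (L / r * `|u|))).
    by rewrite ler_pM ?normc_ge0// integrand_bound.
  by rewrite le_eqVlt; apply/orP; left; apply/eqP; ring.
rewrite normrM ger0_norm; last by rewrite invr_ge0 mulr_ge0 ?ltW.
have H : `|\int[leb]_(u in fourier_itv r) (complex.Re (fourier_integrand r y k u) -
    complex.Re (fourier_integrand r (y + z) (k + m) u))| <=
    \int[leb]_u (L / r * (`|u| * gaussian c u)).
  apply: Rintegral_le_nonneg => //; first exact: measurable_fourier_itv.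
  - by apply: integrableBR; [exact: measurable_fourier_itv|exact: integrable_integrand|exact: integrable_integrand].
  - by apply: integrableZlR => //; exact: integrable_abs_gaussian.
  - by move=> u; rewrite mulr_ge0 ?divr_ge0 ?(ltW r0)// mulr_ge0// gaussian_ge0.
apply: (le_trans (ler_wpM2l _ H)); first by rewrite invr_ge0 mulr_ge0 ?ltW.
rewrite RintegralZl//; last exact: integrable_abs_gaussian.
rewrite -/M -r2.
have -> : (2 * pi * r)^-1 * (L / r * M) = (2 * pi)^-1 * M * L / r ^+ 2.
  by move: (2 * pi) p0 => p p0; field; rewrite !gt_eqF.
rewrite ler_wpM2r ?invr_ge0 ?sqr_ge0//.
have -> : (2 * pi)^-1 * M * (1 + K) * (Num.sqrt m%:R + `|z|) =
   (2 * pi)^-1 * M * ((1 + K) * (Num.sqrt m%:R + `|z|)) by ring.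
rewrite ler_wpM2l ?mulr_ge0 ?invr_ge0 ?(ltW p0)// /L.
have := normr_ge0 z; nra.
Qed.

(** The scale r = sqrt n makes the integrand converge pointwise to the
    Gaussian times cos (kappa u), under the domination of [psiX_gaussian]. *)
Lemma local_limit (x : nat -> R) (kappa : R) :
  x n / Num.sqrt n%:R @[n --> \oo] --> kappa ->
  Num.sqrt n%:R * lattice_mass (Num.sqrt n%:R) n (x n) @[n --> \oo] -->
    (Num.sqrt (2 * pi) * tau)^-1 * expR (- (kappa ^+ 2 / (2 * tau ^+ 2))).
Proof.
move=> xk.
have tau1 : tau != 0 by rewrite gt_eqF.
have t20 : 0 < tau ^+ 2 / 2 by rewrite divr_gt0// exprn_gt0.
pose b := tau ^+ 2 / 2.
pose f_ (n : nat) := (fun u => complex.Re (fourier_integrand (Num.sqrt n%:R) (x n) n u)) \_ (fourier_itv (Num.sqrt n%:R)).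
pose f (u : R) := gaussian b u * cos (kappa * u).
have fE u : f u = complex.Re (Complex (gaussian b u) 0) * cos (kappa * u) by [].
have H : \int[leb]_u f_ n u @[n --> \oo] --> \int[leb]_u f u.
  apply: (@Rintegral_dominated_cvg _ _ _ leb setT f_ f (gaussian c)) => //.
  - move=> n; apply: (measurable_restrictT _ (measurable_fourier_itv _)).1.
    by have /integrableP[/measurable_EFinP] := integrable_integrand (Num.sqrt n%:R) (x n) n.
  - move=> u _.
    have cosn : gaussian b u * cos (x n / Num.sqrt n%:R * u) @[n --> \oo] --> f u.
      apply: cvgMr; apply: continuous_cvg; first exact: continuous_cos.
      exact: cvgMl.
    have D0 : normc (psi (u / Num.sqrt n%:R) ^+ n - Complex (gaussian b u) 0) @[n --> \oo] --> 0.
      have := charf_power_cvg mW iW iW2 EW EW2 u.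
      by rewrite (_ : u ^+ 2 * tau ^+ 2 / 2 = b * u ^+ 2)// /b; ring.
    rewrite -[X in _ --> X]add0r.
    rewrite (_ : (fun n => f_ n u) = (fun n =>
       (f_ n u - gaussian b u * cos (x n / Num.sqrt n%:R * u)) +
       gaussian b u * cos (x n / Num.sqrt n%:R * u))); last first.
      by apply/funext => n; rewrite subrK.
    apply: cvgD => //; apply: norm_cvg0.
    apply: (@squeeze_cvgr _ _ _ _ (cst 0) _ _ _ _ _ D0); last exact: cvg_cst.
    near=> n; rewrite normr_ge0/=.
    have n0 : (0 < n)%N by near: n; exists 1%N.
    have r0 := @sqrtn_gt0 R n n0.
    have Au : fourier_itv (Num.sqrt n%:R) u.
      rewrite /fourier_itv/= in_itv/= -ler_norml -ler_pdivrMl ?pi_gt0//.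
      by near: n; move/cvgryPge : (@cvg_sqrtn R); apply.
    rewrite /f_ patchE mem_set// /fourier_integrand.
    have -> : u / Num.sqrt n%:R * x n = x n / Num.sqrt n%:R * u by ring.
    set y := x n / _ * u; set p := psi _ ^+ n.
    have -> : complex.Re (cis (- y) * p) - gaussian b u * cos y =
        complex.Re (cis (- y) * (p - Complex (gaussian b u) 0)).
      by case: (p) => p1 p2 /=; rewrite cosN subr0; ring.
    by rewrite (le_trans (normr_Re_le _))// normcM normc_cis mul1r.
  - exact: integrable_gaussian.
  - move=> n u _; rewrite /f_ patchE; case: ifPn => [/set_mem Au|_]; last first.
      by rewrite normr0 gaussian_ge0.
    by rewrite (le_trans (normr_Re_le _))// integrand_bound.
have -> : (Num.sqrt (2 * pi) * tau)^-1 * expR (- (kappa ^+ 2 / (2 * tau ^+ 2))) =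
    (2 * pi)^-1 * \int[leb]_u f u.
  rewrite (gaussian_fourier t20) [RHS]mulrA; congr (_ * expR _); last first.
    by rewrite /b; field.
  have p0 : 0 < 2 * pi :> R by rewrite mulr_gt0// pi_gt0.
  have -> : pi / (tau ^+ 2 / 2) = 2 * pi * (tau^-1) ^+ 2 by field.
  rewrite (@sqrtrM _ (2 * pi) (tau^-1 ^+ 2)) ?(ltW p0)//.
  rewrite sqrtr_sqr gtr0_norm ?invr_gt0//.
  set s := Num.sqrt (2 * pi).
  have s0 : 0 < s by rewrite sqrtr_gt0.
  have -> : 2 * pi = s ^+ 2 :> R by rewrite sqr_sqrtr// ltW.
  by field; rewrite tau1 gt_eqF.
apply: (@cvg_trans _ (((2 * pi)^-1 * \int[leb]_u f_ n u) @[n --> \oo])); last exact: cvgMr.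
apply: near_eq_cvg; near=> n.
have n0 : (0 < n)%N by near: n; exists 1%N.
have r0 := @sqrtn_gt0 R n n0.
rewrite /lattice_mass /f_ -Rintegral_mkcond; set I := \int[_]_(_ in _) _.
have p0 : 0 < 2 * pi :> R by rewrite mulr_gt0// pi_gt0.
by move: (2 * pi) p0 => p p0; field; rewrite !gt_eqF.
Unshelve. all: by end_near. Qed.

End local_limit.

(** * Logarithmic averages *)

Section log_average.
Context (R : realType).
Implicit Types (N n k : nat).

Definition harm N : R := \sum_(1 <= n < N.+1) n%:R^-1.

Lemma harmS N : harm N.+1 = harm N + N.+1%:R^-1.
Proof. by rewrite /harm big_nat_recr. Qed.

Lemma ln_natS_le N : (0 < N)%N -> ln (N.+1%:R : R) <= ln N%:R + N%:R^-1.
Proof.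
move=> N0; have N1 : 0 < N%:R :> R by rewrite ltr0n.
have -> : N.+1%:R = N%:R * (1 + N%:R^-1) :> R.
  by rewrite mulrDr mulr1 divff ?gt_eqF// natr1.
rewrite lnM ?posrE// ?addr_gt0 ?invr_gt0//.
rewrite lerD2l le_ln1Dx//; apply: lt_trans (_ : 0 < _); rewrite ?invr_gt0//; lra.
Qed.

Lemma ln_natS_ge N : (0 < N)%N -> ln (N%:R : R) + N.+1%:R^-1 <= ln N.+1%:R.
Proof.
move=> N0; have N1 : 0 < N%:R :> R by rewrite ltr0n.
have N2 : 0 < N.+1%:R :> R by rewrite ltr0n.
have E : N%:R = N.+1%:R * (1 - N.+1%:R^-1) :> R.
  by rewrite mulrBr mulr1 divff ?gt_eqF// -natr1 addrK.
have lt1 : N.+1%:R^-1 < 1 :> R by rewrite invf_lt1// ltr1n.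
rewrite [X in ln X]E lnM ?posrE//; last by rewrite subr_gt0.
have : ln (1 - N.+1%:R^-1) <= - N.+1%:R^-1 :> R by apply: le_ln1Dx; rewrite ltrN2.
by move: (N.+1%:R^-1) (ln (1 - _)) (ln N.+1%:R) => a b c; lra.
Qed.

Lemma harm_bounds N : (0 < N)%N -> ln N%:R <= harm N <= 1 + ln N%:R.
Proof.
move=> N0; apply/andP; split.
  apply: (@le_trans _ _ (ln N.+1%:R)).
    by rewrite ler_ln ?posrE ?ltr0n// ler_nat.
  elim: N {N0} => [|N IH]; first by rewrite ln1 /harm big_geq.
  by rewrite harmS (le_trans (@ln_natS_le N.+1 isT))// lerD2r.
elim: N N0 => // -[|N] IH _.
  by rewrite ln1 addr0 /harm big_nat1 invr1.
by rewrite harmS (le_trans (lerD (IH isT) (lexx _)))// -addrA lerD2l ln_natS_ge.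
Qed.

Lemma cvg_ln_nat : (ln N%:R : R) @[N --> \oo] --> +oo.
Proof.
apply/cvgryPge => A; near=> N.
rewrite -[A]expRK ler_ln ?posrE ?expR_gt0//.
  by near: N; exact: nbhs_infty_ger.
by rewrite ltr0n; near: N; exists 1%N.
Unshelve. all: by end_near. Qed.

(** Cesaro's argument with the weights 1 / n, whose sum is log N up to a
    bounded error. *)
Lemma cvg_log_average (a : nat -> R) (l : R) : a n @[n --> \oo] --> l ->
  (ln N%:R)^-1 * (\sum_(1 <= n < N.+1) n%:R^-1 * a n) @[N --> \oo] --> l.
Proof.
move=> al; apply/cvgrPdist_le => e e0.
have e20 : 0 < e / 2 by rewrite divr_gt0.
have /cvgrPdist_le/(_ _ e20)[N0 _ aN0] := al.
pose t n := n%:R^-1 * `|l - a n|.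
have t0 n : 0 <= t n by rewrite mulr_ge0.
(* Contribution of the indices at which a n is still far from l. *)
pose K := \sum_(1 <= n < N0.+1) t n.
have K0 : 0 <= K by apply: sumr_ge0.
have sumt N : \sum_(1 <= n < N.+1) t n <= K + e / 2 * harm N.
  elim: N => [|N IH]; first by rewrite /harm !big_geq// mulr0 addr0.
  rewrite big_nat_recr//= harmS mulrDr addrA.
  have [NN0|NN0] := ltnP N.+1 N0.
    rewrite (@le_trans _ _ K)//; last first.
      have h0 : 0 <= harm N by apply: sumr_ge0.
      by rewrite -addrA lerDl addr_ge0// mulr_ge0// ltW.
    have KE : K = \sum_(1 <= i < N.+2) t i + \sum_(N.+2 <= i < N0.+1) t i.
      by rewrite /K (big_cat_nat (n := N.+2))//; exact: leqW.
    by rewrite -big_nat_recr//= KE lerDl sumr_ge0.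
  by rewrite lerD// /t mulrC ler_wpM2r// aN0.
near=> N.
have N0' : (0 < N)%N by near: N; exists 1%N.
have lnN : (K + `|l| + e) / (e / 2) + 1 <= ln N%:R.
  by near: N; move/cvgryPge : cvg_ln_nat; apply.
have ln0 : 0 < ln N%:R :> R.
  by apply: lt_le_trans lnN; rewrite ltr_wpDl// divr_ge0 ?(ltW e20)// !addr_ge0// ltW.
have /andP[h1 h2] := harm_bounds N0'.
rewrite -(@ler_pM2l _ (ln N%:R))// -{1}(gtr0_norm ln0) -normrM mulrBr mulVKf ?gt_eqF//.
have -> : ln N%:R * l - \sum_(1 <= n < N.+1) n%:R^-1 * a n =
   \sum_(1 <= n < N.+1) n%:R^-1 * (l - a n) + (ln N%:R - harm N) * l.
  under [in RHS]eq_bigr do rewrite mulrBr.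
  rewrite sumrB -mulr_suml -/(harm N); ring.
have S1 : `|\sum_(1 <= n < N.+1) n%:R^-1 * (l - a n)| <= K + e / 2 * harm N.
  apply: le_trans (sumt N); apply: le_trans (ler_norm_sum _ _ _) _.
  by apply: ler_sum => n _; rewrite normrM ger0_norm.
have S2 : `|(ln N%:R - harm N) * l| <= `|l|.
  rewrite normrM ler_piMl// ler_norml; lra.
apply: le_trans (ler_normD _ _) _.
have S3 : K + `|l| + e <= (ln N%:R - 1) * (e / 2).
  by rewrite -ler_pdivrMr// lerBrDr.
have S4 : e / 2 * harm N <= e / 2 * (1 + ln N%:R) by rewrite ler_wpM2l// ltW.
have := normr_ge0 l; nra.
Unshelve. all: by end_near. Qed.

(** Between two consecutive terms of the subsequence a monotone z is
    squeezed, and ln (2 ^ (k.+1 ^ 2)) / ln (2 ^ (k ^ 2)) = ((k + 1) / k)^2 tends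
    to 1. *)
Lemma cvg_log_average_sub (z : nat -> R) (l : R) :
  (forall n, 0 <= z n) -> (forall m n, (m <= n)%N -> z m <= z n) ->
  (ln (2 ^ (k ^ 2))%:R)^-1 * z (2 ^ (k ^ 2))%N @[k --> \oo] --> l ->
  (ln N%:R)^-1 * z N @[N --> \oo] --> l.
Proof.
move=> z0 zmono zl.
set L : nat -> R := fun k => ln (2 ^ (k ^ 2))%:R.
have l2 : 0 < ln 2 :> R by rewrite ln_gt0// ltr1n.
have LE k : L k = k%:R ^+ 2 * ln 2.
  by rewrite /L natrX lnXn// -natrX mulr_natl.
have ratio : (k.+1%:R / k%:R : R) @[k --> \oo] --> (1 : R).
  apply: (@cvg_dist_le _ _ (fun n => n%:R^-1)); last exact: cvg_invn.
  move=> k k0; have k1 : k%:R != 0 :> R by rewrite pnatr_eq0 -lt0n.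
  have -> : k.+1%:R / k%:R - 1 = k%:R^-1 :> R by rewrite -natr1; field.
  by rewrite ger0_norm.
have rat2 : ((k.+1%:R / k%:R : R) ^+ 2) @[k --> \oo] --> (1 : R).
  under eq_fun do rewrite expr2.
  by have := cvgM ratio ratio; rewrite mulr1; apply.
have rat2V : (((k.+1%:R / k%:R : R) ^+ 2)^-1) @[k --> \oo] --> (1 : R).
  have h := cvgV (oner_neq0 R) rat2; rewrite invr1 in h; exact: h.
have zl1 : (L k.+1)^-1 * z (2 ^ (k.+1 ^ 2))%N @[k --> \oo] --> l.
  have := zl; rewrite -(cvg_shiftS (fun k => (L k)^-1 * z (2 ^ (k ^ 2))%N)); exact.
have up : (L k.+1)^-1 * z (2 ^ (k.+1 ^ 2))%N * (k.+1%:R / k%:R) ^+ 2 @[k --> \oo] --> l.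
  have h := cvgM zl1 rat2; rewrite mulr1 in h; exact: h.
have lo : (L k)^-1 * z (2 ^ (k ^ 2))%N * ((k.+1%:R / k%:R) ^+ 2)^-1 @[k --> \oo] --> l.
  have h := cvgM zl rat2V; rewrite mulr1 in h; exact: h.
apply/cvgrPdist_le => e e0.
have /cvgrPdist_le/(_ _ e0)[K1 _ upK] := up.
have /cvgrPdist_le/(_ _ e0)[K2 _ loK] := lo.
(* The 1 keeps the denominators k and ln (2 ^ (k ^ 2)) away from 0. *)
pose K := maxn 1 (maxn K1 K2).
near=> N.
have NK : (2 ^ (K ^ 2) <= N)%N by near: N; exists (2 ^ (K ^ 2))%N.
have ex : exists k, (2 ^ (k ^ 2) <= N)%N by exists K.
have ub k : (2 ^ (k ^ 2) <= N)%N -> (k <= N)%N.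
  move=> h; apply: leq_trans (leq_trans h (leqnn N)).
  apply: leq_trans (ltnW (ltn_expl _ (ltnSn 1))).
  by case: k {h} => // k; rewrite expnS expn1 leq_pmulr.
case: (ex_maxnP ex ub) => k kN kmax.
have Kk : (K <= k)%N by exact: kmax.
have k0 : (0 < k)%N by apply: leq_trans Kk; rewrite leq_max.
have kN' : (N < 2 ^ (k.+1 ^ 2))%N.
  by rewrite ltnNge; apply/negP => /kmax; rewrite ltnn.
have K1k : (K1 <= k)%N by apply: leq_trans Kk; rewrite !leq_max leqnn orbT.
have K2k : (K2 <= k)%N by apply: leq_trans Kk; rewrite !leq_max leqnn !orbT.
have kr : 0 < k%:R :> R by rewrite ltr0n.
have kr1 : 0 < k.+1%:R :> R by rewrite ltr0n.
have Lk : 0 < L k by rewrite LE mulr_gt0// exprn_gt0.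
have Lk1 : 0 < L k.+1 by rewrite LE mulr_gt0// exprn_gt0.
have N0 : (0 < N)%N by apply: leq_trans NK; rewrite expn_gt0.
have LN : L k <= ln N%:R.
  by rewrite ler_ln ?posrE ?ltr0n ?expn_gt0// ler_nat.
have LN1 : ln N%:R <= L k.+1.
  by rewrite ler_ln ?posrE ?ltr0n ?expn_gt0// ler_nat ltnW.
have lnN : 0 < ln N%:R :> R by apply: lt_le_trans LN.
have hup : (ln N%:R)^-1 * z N <= (L k.+1)^-1 * z (2 ^ (k.+1 ^ 2))%N * (k.+1%:R / k%:R) ^+ 2.
  have -> : (L k.+1)^-1 * z (2 ^ (k.+1 ^ 2))%N * (k.+1%:R / k%:R) ^+ 2 =
     (L k)^-1 * z (2 ^ (k.+1 ^ 2))%N.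
    by rewrite !LE; field; rewrite !gt_eqF.
  by rewrite ler_pM ?invr_ge0 ?(ltW lnN)// ?lef_pV2 ?posrE// zmono// ltnW.
have hlo : (L k)^-1 * z (2 ^ (k ^ 2))%N * ((k.+1%:R / k%:R) ^+ 2)^-1 <= (ln N%:R)^-1 * z N.
  have -> : (L k)^-1 * z (2 ^ (k ^ 2))%N * ((k.+1%:R / k%:R) ^+ 2)^-1 =
     (L k.+1)^-1 * z (2 ^ (k ^ 2))%N.
    by rewrite !LE; field; rewrite !gt_eqF.
  by rewrite ler_pM ?invr_ge0 ?(ltW Lk1)// ?lef_pV2 ?posrE// zmono.
have close (u v s : R) : `|l - u| <= e -> `|l - v| <= e -> s <= u -> v <= s ->
    `|l - s| <= e.
  by rewrite !ler_norml; lra.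
exact: close (upK k K1k) (loK k K2k) hup hlo.
Unshelve. all: by end_near. Qed.

End log_average.

(** * Variance of the weighted count and almost sure convergence *)

Section ae_series.
Context (R : realType) (d : measure_display) (T : measurableType d)
  (P : probability T R).

(** By monotone convergence the series of the f_k has a finite integral,
    hence is almost surely finite, and its general term tends to 0. *)
Lemma ae_cvg0_of_summable (f : nat -> T -> R) (C : R) :
  (forall k, measurable_fun setT (f k)) -> (forall k w, 0 <= f k w) ->
  (forall k, P.-integrable setT (EFin \o f k)) ->
  (forall n, \sum_(0 <= k < n) \int[P]_w f k w <= C) ->
  {ae P, forall w, f k w @[k --> \oo] --> 0}.
Proof.
move=> mf f0 fi fC.
pose S w := (\sum_(0 <= k <oo) (f k w)%:E)%E.
have mfE k : measurable_fun setT (EFin \o f k) by exact/measurable_EFinP.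
have intS : (\int[P]_w S w <= C%:E)%E.
  rewrite (@integral_nneseries _ _ _ P setT measurableT (fun k => EFin \o f k))//=; last first.
    by move=> k w _; rewrite lee_fin.
  apply: lime_le.
    by apply: is_cvg_nneseries => k _ _; apply: integral_ge0 => w _; rewrite lee_fin.
  near=> n.
  have -> : (\sum_(0 <= k < n) \int[P]_w (f k w)%:E =
     \sum_(0 <= k < n) (\int[P]_w f k w)%R%:E)%E.
    apply: eq_bigr => k _.
    have := integrable_fin_num measurableT (fi k) => h.
    by rewrite /Rintegral fineK.
  by rewrite sumEFin lee_fin.
have S0 w : (0 <= S w)%E by apply: nneseries_ge0 => k _ _; rewrite lee_fin.
have mS : measurable_fun setT S.
  apply: (@ge0_emeasurable_sum _ _ _ _ (fun k => EFin \o f k) predT).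
    by move=> k w _ _; rewrite lee_fin.
  by move=> k _; exact: mfE.
have iS : P.-integrable setT S.
  apply/integrableP; split => //.
  under eq_integral do rewrite gee0_abs//.
  exact: le_lt_trans intS (ltry _).
have := integrable_ae measurableT iS.
apply: filterS => w /(_ I) Sfin.
have Slt : (S w < +oo)%E by rewrite ltey_eq Sfin.
have tail := @nneseries_tail_cvg R (fun k => (f k w)%:E) predT Slt.
have {}tail : (\sum_(N <= k <oo) (f k w)%:E)%E @[N --> \oo] --> 0%E.
  by apply: tail => k _; rewrite lee_fin.
have : (f k w)%:E @[k --> \oo] --> 0%E.
  apply: (squeeze_cvge _ (cvg_cst 0%E) tail).
  near=> k; rewrite lee_fin f0/=.
  have := @nneseries_lim_ge R (fun k => (f k w)%:E) predT k k.+1.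
  rewrite big_nat1; apply => j _ _; by rewrite lee_fin.
by move/fine_cvgP => [_].
Unshelve. all: by end_near. Qed.

End ae_series.

(** With r = sqrt m, s = sqrt k and t = sqrt (m + k), the bound C / s^2 is
    used when k >= m and the bound C / (r s) when k <= m; in both cases
    max (r, s) is comparable to t. *)
Lemma cov_arith (R : realType) (C r s t X : R) : 0 <= C ->
  0 < r -> 0 < s -> 0 < t -> t ^+ 2 = r ^+ 2 + s ^+ 2 -> 0 <= X ->
  X <= C / (r * s) -> X <= C / s ^+ 2 ->
  r^-1 * t^-1 * X <= 2 * C * (r^-1 + s^-1) / (t ^+ 2 * t).
Proof.
move=> C0 r0 s0 t0 st X0 h1 h2.
have -> : 2 * C * (r^-1 + s^-1) / (t ^+ 2 * t) =
    r^-1 * t^-1 * (2 * C * (r^-1 + s^-1) * r / t ^+ 2) by field; rewrite !gt_eqF.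
rewrite ler_wpM2l ?mulr_ge0 ?invr_ge0 ?(ltW r0) ?(ltW t0)//.
have -> : 2 * C * (r^-1 + s^-1) * r / t ^+ 2 = 2 * C * (r + s) / (s * t ^+ 2).
  by field; rewrite !gt_eqF.
have rs0 : 0 <= r * s ^+ 2 by rewrite mulr_ge0 ?sqr_ge0 ?(ltW r0).
have ss0 : 0 <= s * (s * r) by rewrite !mulr_ge0 ?(ltW r0) ?(ltW s0).
have [rs|rs] := leP r s.
  apply: (le_trans h2).
  rewrite ler_pdivrMr ?exprn_gt0// mulrAC ler_pdivlMr ?mulr_gt0 ?exprn_gt0//.
  have h : t ^+ 2 <= 2 * s ^+ 2 by nra.
  have h' : s * t ^+ 2 <= 2 * (r + s) * s ^+ 2.
    have : s * t ^+ 2 <= s * (2 * s ^+ 2) by rewrite ler_wpM2l// ltW.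
    lra.
  by rewrite -[leRHS]mulrA -[leRHS]mulrA [leRHS]mulrCA ler_wpM2l// mulrA.
apply: (le_trans h1).
rewrite ler_pdivrMr ?mulr_gt0// mulrAC ler_pdivlMr ?mulr_gt0 ?exprn_gt0//.
have h : t ^+ 2 <= 2 * r ^+ 2 by nra.
have h' : s * t ^+ 2 <= 2 * (r + s) * (r * s).
  have : s * t ^+ 2 <= s * (2 * r ^+ 2) by rewrite ler_wpM2l// ltW.
  lra.
by rewrite -[leRHS]mulrA -[leRHS]mulrA [leRHS]mulrCA ler_wpM2l// mulrA.
Qed.

Section variance.
Context (R : realType) (d : measure_display) (T : measurableType d)
  (P : probability T R) (B : nat -> set T) (C : R).
Hypotheses (mB : forall n, measurable (B n)) (C0 : 0 <= C).
Let p n : R := fine (P (B n)).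
Hypotheses
  (cov1 : forall m k, (0 < m)%N -> (0 < k)%N ->
    `|fine (P (B m `&` B (m + k)%N)) - p m * p (m + k)%N| <=
      C / (Num.sqrt m%:R * Num.sqrt k%:R))
  (cov2 : forall m k, (0 < m)%N -> (0 < k)%N ->
    `|fine (P (B m `&` B (m + k)%N)) - p m * p (m + k)%N| <= C / k%:R).

Let y n w : R := (Num.sqrt n%:R)^-1 * (\1_(B n) w - p n).

(** A class stable under sums and products in which every function is
    integrable, so that no integrability question arises when squares of sums
    are expanded. *)
Definition bounded_meas (f : T -> R) :=
  measurable_fun setT f /\ exists M, forall w, `|f w| <= M.

Lemma bounded_meas_integrable f : bounded_meas f -> P.-integrable setT (EFin \o f).
Proof. by move=> [mf [M fM]]; exact: (@prob_bounded_integrable _ _ _ P _ M). Qed.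

Lemma bounded_measD f g : bounded_meas f -> bounded_meas g ->
  bounded_meas (fun w => f w + g w).
Proof.
move=> [mf [M fM]] [mg [N gN]]; split; first exact: measurable_funD.
by exists (M + N) => w; rewrite (le_trans (ler_normD _ _))// lerD.
Qed.

Lemma bounded_measM f g : bounded_meas f -> bounded_meas g ->
  bounded_meas (fun w => f w * g w).
Proof.
move=> [mf [M fM]] [mg [N gN]]; split; first exact: measurable_funM.
by exists (M * N) => w; rewrite normrM ler_pM.
Qed.

Lemma bounded_meas_cst (a : R) : bounded_meas (cst a).
Proof. by split => //; exists `|a|. Qed.

Lemma bounded_meas_indic (E : set T) : measurable E -> bounded_meas (\1_E).
Proof.
move=> mE; split; first exact: measurable_indic.
by exists 1 => w; rewrite indicE; case: (_ \in _); rewrite ?normr1 ?normr0.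
Qed.

Lemma bounded_meas_sum (f : nat -> T -> R) N : (forall n, bounded_meas (f n)) ->
  bounded_meas (fun w => \sum_(1 <= n < N.+1) f n w).
Proof.
move=> fb; elim: N => [|N IH].
  by rewrite (_ : (fun _ => _) = cst 0); [exact: bounded_meas_cst|apply/funext => w; rewrite big_geq].
rewrite (_ : (fun _ => _) = fun w => \sum_(1 <= n < N.+1) f n w + f N.+1 w).
  exact: bounded_measD.
by apply/funext => w; rewrite big_nat_recr.
Qed.

Lemma bounded_meas_y n : bounded_meas (y n).
Proof.
apply: (bounded_measM (bounded_meas_cst _)).
by apply: (bounded_measD (bounded_meas_indic (mB n)) (bounded_meas_cst (- p n))).
Qed.

Lemma Rintegral_indic (E : set T) : measurable E -> \int[P]_w \1_E w = fine (P E).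
Proof. by move=> mE; rewrite /Rintegral integral_indic// setIT. Qed.

Lemma Rintegral_yy m n : \int[P]_w (y m w * y n w) =
  (Num.sqrt m%:R)^-1 * (Num.sqrt n%:R)^-1 * (fine (P (B m `&` B n)) - p m * p n).
Proof.
have mI : measurable (B m `&` B n) by exact: measurableI.
have bI := bounded_meas_integrable (bounded_meas_indic mI).
have bm := bounded_meas_integrable (bounded_meas_indic (mB m)).
have bn := bounded_meas_integrable (bounded_meas_indic (mB n)).
have bc := bounded_meas_integrable (bounded_meas_cst (p m * p n)).
transitivity (\int[P]_w ((Num.sqrt m%:R)^-1 * (Num.sqrt n%:R)^-1 *
   ((\1_(B m `&` B n) w + p m * p n) - (p n * \1_(B m) w + p m * \1_(B n) w)))).
  by apply: eq_Rintegral => w _; rewrite /y indicI /=; ring.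
have i1 : P.-integrable setT (EFin \o (fun w => \1_(B m `&` B n) w + p m * p n)).
  exact: integrableDR.
have i2 : P.-integrable setT (EFin \o (fun w => p n * \1_(B m) w + p m * \1_(B n) w)).
  by apply: integrableDR => //; exact: integrableZlR.
rewrite RintegralZl//; last exact: integrableBR.
congr (_ * _); rewrite RintegralB// RintegralD// RintegralD//; [|exact: integrableZlR|exact: integrableZlR].
rewrite (Rintegral_cst1 P (p m * p n)) RintegralZl// RintegralZl//.
rewrite !Rintegral_indic// -/(p m) -/(p n); ring.
Qed.

Let S N w : R := \sum_(1 <= n < N.+1) y n w.

Lemma sum_invsqrt_le n : \sum_(1 <= m < n.+1) (Num.sqrt m%:R)^-1 <= 2 * Num.sqrt n%:R :> R.
Proof.
elim: n => [|n IH]; first by rewrite big_geq// mulr_ge0// sqrtr_ge0.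
rewrite big_nat_recr//=.
have a0 := sqrtr_ge0 (n%:R : R).
have b0 : 0 < Num.sqrt n.+1%:R :> R by exact: sqrtn_gt0.
have a2 : Num.sqrt n%:R ^+ 2 = n%:R :> R by exact: sqr_sqrtn.
have b2 : Num.sqrt n.+1%:R ^+ 2 = n%:R + 1 :> R by rewrite sqr_sqrtn natr1.
apply: (le_trans (lerD IH (lexx _))).
have key (a b c : R) : 0 <= a -> 0 < b -> a ^+ 2 = c -> b ^+ 2 = c + 1 ->
    2 * a + b^-1 <= 2 * b.
  move=> {}a0 {}b0 {}a2 {}b2.
  rewrite -(ler_pM2r b0) mulrDl mulVf ?gt_eqF//.
  have := sqr_ge0 (a - b); nra.
exact: key a2 b2.
Qed.

Lemma cov_term m k : (0 < m)%N -> (0 < k)%N ->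
  `|\int[P]_w (y m w * y (m + k)%N w)| <=
   2 * C * ((Num.sqrt m%:R)^-1 + (Num.sqrt k%:R)^-1) / ((m + k)%:R * Num.sqrt (m + k)%:R).
Proof.
move=> m0 k0; rewrite Rintegral_yy normrM.
have r0 := @sqrtn_gt0 R m m0; have r2 := sqr_sqrtn R m.
have s0 := @sqrtn_gt0 R k k0; have s2 := sqr_sqrtn R k.
have t0 : 0 < Num.sqrt (m + k)%:R :> R by apply: sqrtn_gt0; rewrite addn_gt0 m0.
have t2 := sqr_sqrtn R (m + k).
have h1 := cov1 m0 k0; have h2 := cov2 m0 k0.
rewrite [X in X * _]gtr0_norm ?mulr_gt0 ?invr_gt0//.
rewrite -s2 in h2; rewrite -[X in _ / (X * _)]t2.
apply: cov_arith => //.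
by rewrite !sqr_sqrtn natrD.
Qed.

(** By induction on N.  Passing from N to n = N + 1 adds the variance of
    one term, at most 1 / n, and twice its covariances with the earlier terms.
    By [cov_term] the latter are at most
    2 C n^(- 3 / 2) (m^(- 1 / 2) + (n - m)^(- 1 / 2)), and summing over m < n
    gives O(1 / n). *)
Lemma variance_le N : \int[P]_w (S N w ^+ 2) <= (16 * C + 1) * harm R N.
Proof.
have bS M : bounded_meas (S M) by apply: bounded_meas_sum => n; exact: bounded_meas_y.
elim: N => [|N IH].
  rewrite /harm big_geq// mulr0.
  rewrite (_ : (fun w => _) = cst 0) ?(Rintegral_cst1 P 0)//.
  by apply/funext => w; rewrite /S big_geq// expr0n.
pose n := N.+1.
have SE w : S N.+1 w ^+ 2 = S N w ^+ 2 + (2 * (\sum_(1 <= m < N.+1) y m w * y n w) + y n w * y n w).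
  by rewrite /S big_nat_recr//= -mulr_suml; ring.
under eq_Rintegral do rewrite SE.
have iSS : P.-integrable setT (EFin \o (fun w => S N w ^+ 2)).
  by apply: bounded_meas_integrable; exact: bounded_measM.
have iyy m k : bounded_meas (fun w => y m w * y k w).
  by apply: bounded_measM; exact: bounded_meas_y.
have isum M : bounded_meas (fun w => \sum_(1 <= m < M.+1) y m w * y n w).
  by apply: bounded_meas_sum.
have Isum M : \int[P]_w (\sum_(1 <= m < M.+1) y m w * y n w) =
    \sum_(1 <= m < M.+1) \int[P]_w (y m w * y n w).
  elim: M => [|M IHM].
    rewrite big_geq// (_ : (fun w => _) = cst 0) ?(Rintegral_cst1 P 0)//.
    by apply/funext => w; rewrite big_geq.
  rewrite big_nat_recr//= -IHM -RintegralD//; last 2 first.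
  - exact: bounded_meas_integrable.
  - exact: bounded_meas_integrable.
  by apply: eq_Rintegral => w _; rewrite big_nat_recr.
have i2 : P.-integrable setT (EFin \o (fun w => 2 * (\sum_(1 <= m < N.+1) y m w * y n w))).
  by apply: integrableZlR => //; exact: bounded_meas_integrable.
have i3 := bounded_meas_integrable (iyy n n).
rewrite RintegralD//; last exact: integrableDR.
rewrite RintegralD// RintegralZl//; last exact: bounded_meas_integrable.
rewrite Isum harmS mulrDr lerD//.
have n0 : 0 < n%:R :> R by rewrite ltr0n.
have t0 : 0 < Num.sqrt n%:R :> R by exact: sqrtn_gt0.
have diag : \int[P]_w (y n w * y n w) <= n%:R^-1.
  rewrite Rintegral_yy setIid -invfM -expr2 sqr_sqrtn.
  rewrite ler_piMr ?invr_ge0 ?(ltW n0)//.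
  have : p n <= 1 by rewrite -lee_fin /p fineK ?probability_le1// fin_num_measure.
  by rewrite -/(p n); have := sqr_ge0 (p n); nra.
have off : \sum_(1 <= m < N.+1) \int[P]_w (y m w * y n w) <= 8 * C / n%:R.
  apply: (@le_trans _ _ (\sum_(1 <= m < N.+1)
     (2 * C / (n%:R * Num.sqrt n%:R)) * ((Num.sqrt m%:R)^-1 + (Num.sqrt (n - m)%:R)^-1))).
    apply: ler_sum_nat => m /andP[m0 mN].
    have := @cov_term m (n - m) m0; rewrite subnKC; last by rewrite ltnW.
    rewrite subn_gt0 => /(_ mN) h.
    by rewrite (le_trans (ler_norm _))// (le_trans h)// mulrAC.
  rewrite -mulr_sumr big_split/=.
  (* m |-> n - m permutes the indices 1, ..., N. *)
  have rev : \sum_(1 <= m < N.+1) (Num.sqrt (n - m)%:R)^-1 = \sum_(1 <= m < N.+1) (Num.sqrt m%:R)^-1 :> R.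
    by rewrite [RHS]big_nat_rev/=; apply: eq_bigr => m _; rewrite add1n.
  rewrite rev.
  have h : \sum_(1 <= m < N.+1) (Num.sqrt m%:R)^-1 <= 2 * Num.sqrt n%:R :> R.
    rewrite (le_trans (sum_invsqrt_le N))// ler_wpM2l// ler_sqrt// ?ler0n// ler_nat.
    exact: leqnSn.
  have -> : 8 * C / n%:R = 2 * C / (n%:R * Num.sqrt n%:R) * (2 * Num.sqrt n%:R + 2 * Num.sqrt n%:R).
    by field; rewrite !gt_eqF.
  by rewrite ler_wpM2l ?lerD// divr_ge0 ?mulr_ge0 ?(ltW t0) ?(ltW n0).
have -> : (16 * C + 1) / N.+1%:R = 2 * (8 * C / n%:R) + n%:R^-1 by rewrite -/n; field; rewrite gt_eqF.
by rewrite lerD// ler_pM2l.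
Qed.

Lemma leq_exp2sqr k : (k <= 2 ^ (k ^ 2))%N.
Proof.
apply: leq_trans (ltnW (ltn_expl _ (ltnSn 1))).
by case: k => // k; rewrite expnS expn1 leq_pmulr.
Qed.

(** The partial sums up to 1 / (m + 1)^2 are at most 2 - 1 / (m + 1). *)
Lemma sum_invsqr_le n : \sum_(0 <= k < n) (k.+1%:R ^+ 2)^-1 <= 2 :> R.
Proof.
suff h m : \sum_(0 <= k < m.+1) (k.+1%:R ^+ 2)^-1 <= 2 - m.+1%:R^-1 :> R.
  case: n => [|n]; first by rewrite big_geq.
  by rewrite (le_trans (h n))// lerBlDr lerDl.
elim: m => [|m IH]; first by rewrite big_nat1 expr1n invr1; lra.
rewrite big_nat_recr//= (le_trans (lerD IH (lexx _)))//.
have key (x : R) : 0 < x -> 2 - x^-1 + ((x + 1) ^+ 2)^-1 <= 2 - (x + 1)^-1.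
  move=> x0; have x1 : 0 < x + 1 by rewrite addr_gt0.
  rewrite -subr_ge0.
  have -> : 2 - (x + 1)^-1 - (2 - x^-1 + ((x + 1) ^+ 2)^-1) = (x * (x + 1) ^+ 2)^-1.
    by field; rewrite !gt_eqF.
  by rewrite invr_ge0 mulr_ge0 ?sqr_ge0// ltW.
by rewrite -[m.+2%:R]natr1; apply: key; rewrite ltr0n.
Qed.

(** The normalised variances along 2 ^ (k.+1 ^ 2) are
    O(1 / ln (2 ^ (k.+1 ^ 2))) = O(1 / (k + 1)^2), a summable sequence. *)
Lemma ae_S_subseq :
  {ae P, forall w, (ln (2 ^ (k.+1 ^ 2))%:R)^-1 * S (2 ^ (k.+1 ^ 2)) w @[k --> \oo] --> (0 : R)}.
Proof.
set L : nat -> R := fun k => ln (2 ^ (k.+1 ^ 2))%:R.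
have l2 : 0 < ln 2 :> R by rewrite ln_gt0// ltr1n.
have LE k : L k = k.+1%:R ^+ 2 * ln 2.
  by rewrite /L natrX lnXn// -natrX mulr_natl.
pose f k w := (L k)^-1 ^+ 2 * S (2 ^ (k.+1 ^ 2)) w ^+ 2.
have bS M : bounded_meas (S M) by apply: bounded_meas_sum => n; exact: bounded_meas_y.
have bf k : bounded_meas (f k).
  by apply: bounded_measM; [exact: bounded_meas_cst|exact: bounded_measM].
pose K := (16 * C + 1) * ((ln 2)^-1 ^+ 2 + (ln 2)^-1).
have K0 : 0 <= K by rewrite mulr_ge0 ?addr_ge0 ?mulr_ge0 ?sqr_ge0 ?invr_ge0 ?(ltW l2).
have fK k : \int[P]_w f k w <= K * (k.+1%:R ^+ 2)^-1.
  rewrite RintegralZl//; last by apply: bounded_meas_integrable; exact: bounded_measM.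
  apply: (@le_trans _ _ ((L k)^-1 ^+ 2 * ((16 * C + 1) * (1 + L k)))).
    rewrite ler_wpM2l ?sqr_ge0// (le_trans (variance_le _))// ler_wpM2l//.
      by rewrite addr_ge0// mulr_ge0.
    have e0 : (0 < 2 ^ (k.+1 ^ 2))%N by rewrite expn_gt0.
    by have /andP[] := @harm_bounds R _ e0.
  rewrite LE.
  have key (x l a : R) : 1 <= x -> 0 < l -> 0 <= a ->
      (x * l)^-1 ^+ 2 * (a * (1 + x * l)) <= a * (l^-1 ^+ 2 + l^-1) * x^-1.
    move=> x1 l0 a0; have x0 : 0 < x by apply: lt_le_trans x1.
    have -> : (x * l)^-1 ^+ 2 * (a * (1 + x * l)) = a * (l^-1 ^+ 2 * x^-1 + l^-1) * x^-1.
      by field; rewrite !gt_eqF.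
    rewrite ler_wpM2r ?invr_ge0 ?(ltW x0)// ler_wpM2l// lerD2r.
    by rewrite ler_piMr ?sqr_ge0// invf_le1.
  apply: key => //; last by rewrite addr_ge0// mulr_ge0.
  by rewrite exprn_ege1// ler1n.
have fi k := bounded_meas_integrable (bf k).
have := @ae_cvg0_of_summable _ _ _ P f (K * 2) (fun k => (bf k).1) _ fi _.
have f0 k w : 0 <= f k w by rewrite mulr_ge0// sqr_ge0.
have fC n : \sum_(0 <= k < n) \int[P]_w f k w <= K * 2.
  apply: (@le_trans _ _ (\sum_(0 <= k < n) K * (k.+1%:R ^+ 2)^-1)).
    by apply: ler_sum => k _; exact: fK.
  by rewrite -mulr_sumr ler_wpM2l// sum_invsqr_le.
move=> /(_ f0 fC); apply: filterS => w f_w.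
apply: norm_cvg0.
have : Num.sqrt (f k w) @[k --> \oo] --> Num.sqrt (0 : R).
  by apply: continuous_cvg f_w; exact: sqrt_continuous.
rewrite sqrtr0; apply: cvg_trans; apply: near_eq_cvg; near=> k.
by rewrite /f -exprMn sqrtr_sqr.
Unshelve. all: by end_near. Qed.

(** The count is the sum of its centred part, treated by [ae_S_subseq], and
    of its mean, treated by [cvg_log_average]; since the count is nondecreasing
    in N, convergence along the subsequence is enough. *)
Lemma ae_log_average (l : R) : Num.sqrt n%:R * p n @[n --> \oo] --> l ->
  {ae P, forall w, (ln N%:R)^-1 *
     (\sum_(1 <= n < N.+1) (Num.sqrt n%:R)^-1 * \1_(B n) w) @[N --> \oo] --> l}.
Proof.
move=> pl.
have := cvg_log_average pl.
set M := fun N => _ * _ => Ml.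
have sub : (2 ^ (k.+1 ^ 2))%N @[k --> \oo] --> \oo.
  move=> A [N _ NA]; exists N => // k /= Nk; apply: NA => /=.
  exact: leq_trans (leq_trans Nk (leqnSn k)) (leq_exp2sqr _).
have Msub := cvg_comp _ _ sub Ml.
have := ae_S_subseq; apply: filterS => w Sw.
pose z N := \sum_(1 <= n < N.+1) (Num.sqrt n%:R)^-1 * \1_(B n) w : R.
apply: (@cvg_log_average_sub R z).
- by move=> n; apply: sumr_ge0 => k _; rewrite mulr_ge0 ?invr_ge0 ?sqrtr_ge0.
- move=> m n mn; rewrite /z (big_cat_nat (n := m.+1) (p := n.+1))//= lerDl.
  by apply: sumr_ge0 => k _; rewrite mulr_ge0 ?invr_ge0 ?sqrtr_ge0.
rewrite -(cvg_shiftS (fun k => (ln (2 ^ (k ^ 2))%:R)^-1 * z (2 ^ (k ^ 2))%N)).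
have H : (ln (2 ^ (k.+1 ^ 2))%:R)^-1 * S (2 ^ (k.+1 ^ 2)) w + M (2 ^ (k.+1 ^ 2))%N
    @[k --> \oo] --> l.
  by have h := cvgD Sw Msub; rewrite add0r in h; exact: h.
rewrite (_ : (fun k => (ln (2 ^ (k.+1 ^ 2))%:R)^-1 * z (2 ^ (k.+1 ^ 2))%N) =
  (fun k => (ln (2 ^ (k.+1 ^ 2))%:R)^-1 * S (2 ^ (k.+1 ^ 2)) w + M (2 ^ (k.+1 ^ 2))%N))//.
apply/funext => k; rewrite /M -mulrDr; congr (_ * _).
rewrite /S /z -big_split/=.
apply: eq_big_nat => n /andP[n0 _]; rewrite /y.
have r0 := @sqrtn_gt0 R n n0; have r2 := sqr_sqrtn R n.
have -> : n%:R^-1 * (Num.sqrt n%:R * p n) = (Num.sqrt n%:R)^-1 * p n.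
  have key (x c : R) : 0 < x -> (x ^+ 2)^-1 * (x * c) = x^-1 * c.
    by move=> x0; field; rewrite gt_eqF.
  by rewrite -(key _ (p n) r0) r2.
by rewrite -mulrDr subrK.
Qed.

End variance.

(** * The almost sure local limit theorem *)

Section standardize.
Context (R : realType) (d : measure_display) (T : measurableType d)
  (P : probability T R) (X : {RV P >-> R}) (D mu sigma : R).
Hypotheses (D0 : 0 < D) (X_L2 : (X : T -> R) \in Lfun P 2%:E)
  (muE : mu%:E = 'E_P[X]%E)
  (sigma2E : ((sigma ^+ 2)%:E = 'E_P[(X : T -> R) ^+ 2] - 'E_P[X] ^+ 2)%E).

Let W w := (X w - mu) / D.

Lemma standardize_moments :
  [/\ P.-integrable setT (EFin \o W),
      P.-integrable setT (EFin \o (fun w => W w ^+ 2)),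
      \int[P]_w W w = 0 & \int[P]_w (W w ^+ 2) = (sigma / D) ^+ 2].
Proof.
have D1 : D != 0 by rewrite gt_eqF.
have iX2 : P.-integrable setT (EFin \o (fun w => X w ^+ 2)).
  exact: Lfun2_integrable_sqr.
have iX : P.-integrable setT (EFin \o X).
  by apply/Lfun1_integrable; apply: Lfun_subset12 => //; exact: fin_num_measure.
have i1 a : P.-integrable setT (EFin \o cst a).
  by apply: (@prob_bounded_integrable _ _ _ P _ `|a|).
have EX : \int[P]_w X w = mu by rewrite /Rintegral -[RHS]/(fine mu%:E) muE unlock.
have EX2 : \int[P]_w (X w ^+ 2) = sigma ^+ 2 + mu ^+ 2.
  have h : 'E_P[(X : T -> R) ^+ 2]%E = (\int[P]_w (X w ^+ 2))%R%:E.
    by rewrite unlock /Rintegral fineK//; exact: (integrable_fin_num measurableT iX2).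
  move: sigma2E; rewrite h -muE -EFin_expe -EFinB => -[->]; ring.
have iXm : P.-integrable setT (EFin \o (fun w => X w - mu)).
  exact: (integrableBR measurableT iX (i1 mu)).
have iZ : P.-integrable setT (EFin \o (fun w => X w ^+ 2 - (2 * mu) * X w)).
  by apply: integrableBR => //; exact: integrableZlR.
have iZZ : P.-integrable setT (EFin \o (fun w => X w ^+ 2 - (2 * mu) * X w + mu ^+ 2)).
  exact: (integrableDR measurableT iZ (i1 _)).
have WE : W = fun w => D^-1 * (X w - mu) by apply/funext => w; rewrite /W mulrC.
have W2E : (fun w => W w ^+ 2) = fun w => D^-1 ^+ 2 * (X w ^+ 2 - (2 * mu) * X w + mu ^+ 2).
  by apply/funext => w; rewrite /W; field.
split.
- by rewrite WE; exact: integrableZlR.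
- by rewrite W2E; exact: integrableZlR.
- rewrite WE RintegralZl// (RintegralB measurableT iX (i1 mu)) EX.
  by rewrite (Rintegral_cst1 P mu) subrr mulr0.
- rewrite W2E RintegralZl// (RintegralD measurableT iZ (i1 (mu ^+ 2))).
  rewrite (Rintegral_cst1 P (mu ^+ 2)) (RintegralB measurableT iX2); last exact: integrableZlR.
  by rewrite RintegralZl// EX EX2; field.
Qed.

End standardize.

Theorem theorem4p1 (R : realType)
    (d0 : measure_display) (T0 : measurableType d0) (P0 : probability T0 R)
    (X : {RV P0 >-> R}) (v0 D mu sigma : R)
    (D_gt0 : 0 < D)
    (X_L2 : (X : T0 -> R) \in Lfun P0 2%:E)
    (X_span : maximal_span X v0 D)
    (muE : mu%:E = 'E_P0[X]%E)
    (sigma2E : ((sigma ^+ 2)%:E = 'E_P0[(X : T0 -> R) ^+ 2] - 'E_P0[X] ^+ 2)%E)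
    (sigma_gt0 : 0 < sigma)
    (d : measure_display) (T : measurableType d) (P : probability T R)
    (X_ : nat -> {RV P >-> R})
    (X_indep : mutually_independent X_)
    (X_copies : forall k, same_law (X_ k) X)
    (kappa : R) (kappa_ : nat -> int)
    (kappa_lattice : forall n, (1 <= n)%N ->
       lattice (n%:R * v0) D (kappa_ n)%:~R)
    (kappa_lim : ((kappa_ n)%:~R - n%:R * mu) / Num.sqrt n%:R
       @[n --> \oo] --> kappa) :
  {ae P, forall w,
    (ln N%:R)^-1 *
      (\sum_(1 <= n < N.+1)
         (Num.sqrt n%:R)^-1 *
         \1_[set w' | partial_sum X_ n w' = (kappa_ n)%:~R] w)
    @[N --> \oo] -->
    D / (Num.sqrt (2 * pi) * sigma) *
      expR (- (kappa ^+ 2 / (2 * sigma ^+ 2)))}.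
Proof.
have D1 : D != 0 by rewrite gt_eqF.
have s1 : sigma != 0 by rewrite gt_eqF.
have PL := X_span.1.
pose W w := (X w - mu) / D.
have [iW iW2 EW EW2] := standardize_moments D_gt0 X_L2 muE sigma2E.
have mW : measurable_fun setT W.
  by apply: measurable_funM => //; exact: measurable_funB.
have tau0 : 0 < sigma / D by rewrite divr_gt0.
have [c [c0 psi_bound]] := charf_lattice_bound mu D_gt0 X_span.
have [C1 [C10 bnd]] := local_bound mW c0 psi_bound.
have [C2 [C20 incr]] := local_increment mW iW iW2 EW EW2 c0 psi_bound.
pose x n : R := ((kappa_ n)%:~R - n%:R * mu) / D.
have x_lim : x n / Num.sqrt n%:R @[n --> \oo] --> kappa / D.
  rewrite (_ : (fun n => x n / _) =
    (fun n => ((kappa_ n)%:~R - n%:R * mu) / Num.sqrt n%:R * D^-1)); last first.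
    by apply/funext => n; rewrite /x mulrAC.
  exact: cvgMl.
have [M [M0 xM]] : exists M : R, 0 <= M /\ forall n, (0 < n)%N -> `|x n| <= M * Num.sqrt n%:R.
  have /cvg_ex/cvg_seq_bounded [A [_ hA]] : exists l : R, x n / Num.sqrt n%:R @[n --> \oo] --> l.
    by exists (kappa / D).
  have Ap : A < `|A| + 1 by rewrite (le_lt_trans (ler_norm A))// ltrDl.
  exists (`|A| + 1); split; first by rewrite addr_ge0.
  move=> n n0; have r0 := @sqrtn_gt0 R n n0.
  have := hA _ Ap n I; rewrite /= normrM (@gtr0_norm _ (_^-1)) ?invr_gt0//.
  by rewrite ler_pdivrMr.
pose B n := [set w' | partial_sum X_ n w' = (kappa_ n)%:~R].
have BE n : B n = block X_ 0 n @^-1` [set (kappa_ n)%:~R].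
  apply/seteqP; split=> w; rewrite /B /preimage /= /partial_sum ?big_mkord//.
have mB n : measurable (B n).
  by rewrite BE; apply: measurable_RV_preimage; exact: measurable_set1.
have pE n (r : R) : (0 < n)%N -> 0 < r ->
    fine (P (B n)) = lattice_mass P0 W r n (x n).
  move=> n0 r0; rewrite BE.
  have lat : lattice ((n - 0)%:R * v0) D (kappa_ n)%:~R by rewrite subn0; exact: kappa_lattice.
  have sx : (kappa_ n)%:~R = (n - 0)%:R * mu + D * x n by rewrite subn0 /x; field.
  rewrite (block_prob D_gt0 PL X_indep X_copies (leq0n n) r0 lat sx).
  by rewrite subn0.
have p2E m k (r : R) : (0 < m)%N -> (0 < k)%N -> 0 < r ->
    fine (P (B m `&` B (m + k)%N)) = fine (P (B m)) * lattice_mass P0 W r k (x (m + k)%N - x m).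
  move=> m0 k0 r0; have mmk : (m <= m + k)%N by rewrite leq_addr.
  pose s : R := (kappa_ (m + k)%N)%:~R - (kappa_ m)%:~R.
  have -> : B m `&` B (m + k)%N =
      block X_ 0 m @^-1` [set (kappa_ m)%:~R] `&` block X_ m (m + k) @^-1` [set s].
    rewrite !BE; apply/seteqP.
    have blk w : block X_ 0 (m + k) w = block X_ 0 m w + block X_ m (m + k) w.
      by rewrite !blockE -big_cat_nat.
    split=> w [h1 h2]; split=> //.
      move: h2; rewrite /preimage /mkset /set1 /mkset blk h1 /s => <-; ring.
    move: h2; rewrite /preimage /mkset /set1 /mkset blk h1 /s => ->; ring.
  have mk1 (a : R) : measurable [set a] by exact: measurable_set1.
  rewrite (block_indep X_indep mmk (mk1 _) (mk1 _)) fineM; last 2 first.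
  - by apply: fin_num_measure; apply: measurable_RV_preimage.
  - by apply: fin_num_measure; apply: measurable_RV_preimage.
  rewrite -BE; congr (_ * _).
  have mkm : (m + k - m = k)%N by rewrite addKn.
  have lat : lattice ((m + k - m)%:R * v0) D s.
    have [j _ jE] := kappa_lattice m m0.
    have [i _ iE] : lattice ((m + k)%:R * v0) D (kappa_ (m + k)%N)%:~R.
      by apply: kappa_lattice; rewrite addn_gt0 m0.
    exists (i - j) => //; rewrite mkm /s -jE -iE rmorphB/= natrD; ring.
  have sx : s = (m + k - m)%:R * mu + D * (x (m + k)%N - x m).
    by rewrite mkm /s /x natrD; field.
  rewrite (block_prob D_gt0 PL X_indep X_copies mmk r0 lat sx).
  by rewrite mkm.
(* The two summands serve the two covariance bounds: C1 / sqrt m bounds the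
   probability of B m; the other factor is 2 C1 / sqrt k by the local bound at
   both points, and C2 (1 + M) sqrt m / k by the increment. *)
pose C := 2 * C1 * C1 + C1 * (C2 * (1 + M)).
have C0 : 0 <= C by rewrite addr_ge0// !mulr_ge0// addr_ge0.
have p_bnd n : (0 < n)%N -> `|fine (P (B n))| <= C1 / Num.sqrt n%:R.
  by move=> n0; rewrite (pE n _ n0 (sqrtn_gt0 R n0)) bnd.
have covE m k : (0 < m)%N -> (0 < k)%N ->
    fine (P (B m `&` B (m + k)%N)) - fine (P (B m)) * fine (P (B (m + k)%N)) =
    fine (P (B m)) * (lattice_mass P0 W (Num.sqrt k%:R) k (x (m + k)%N - x m) - fine (P (B (m + k)%N))).
  by move=> m0 k0; rewrite (p2E m k _ m0 k0 (sqrtn_gt0 R k0)) mulrBr.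
have cov1 m k : (0 < m)%N -> (0 < k)%N ->
    `|fine (P (B m `&` B (m + k)%N)) - fine (P (B m)) * fine (P (B (m + k)%N))| <=
    C / (Num.sqrt m%:R * Num.sqrt k%:R).
  move=> m0 k0; have r0 := @sqrtn_gt0 R m m0; have s0 := @sqrtn_gt0 R k k0.
  have mk0 : (0 < m + k)%N by rewrite addn_gt0 m0.
  rewrite covE// normrM.
  have h : `|lattice_mass P0 W (Num.sqrt k%:R) k (x (m + k)%N - x m) - fine (P (B (m + k)%N))| <=
      2 * C1 / Num.sqrt k%:R.
    rewrite (le_trans (ler_normB _ _))//.
    have -> : 2 * C1 / Num.sqrt k%:R = C1 / Num.sqrt k%:R + C1 / Num.sqrt k%:R by ring.
    rewrite lerD ?bnd// (le_trans (p_bnd _ mk0))// ler_wpM2l// lef_pV2 ?posrE ?sqrtn_gt0//.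
    by rewrite ler_sqrt ?ler0n// ler_nat leq_addl.
  rewrite (le_trans (ler_pM _ _ (p_bnd _ m0) h))//.
  have -> : C1 / Num.sqrt m%:R * (2 * C1 / Num.sqrt k%:R) =
      2 * C1 * C1 / (Num.sqrt m%:R * Num.sqrt k%:R) by rewrite invfM; ring.
  rewrite ler_wpM2r ?invr_ge0 ?mulr_ge0 ?(ltW r0) ?(ltW s0)// /C lerDl.
  by rewrite !mulr_ge0// addr_ge0.
have cov2 m k : (0 < m)%N -> (0 < k)%N ->
    `|fine (P (B m `&` B (m + k)%N)) - fine (P (B m)) * fine (P (B (m + k)%N))| <=
    C / k%:R.
  move=> m0 k0; have r0 := @sqrtn_gt0 R m m0; have s0 := @sqrtn_gt0 R k k0.
  have k1 : 0 < k%:R :> R by rewrite ltr0n.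
  have mk0 : (0 < m + k)%N by rewrite addn_gt0 m0.
  rewrite covE// normrM (pE (m + k)%N _ mk0 s0).
  have h : `|lattice_mass P0 W (Num.sqrt k%:R) k (x (m + k)%N - x m) -
      lattice_mass P0 W (Num.sqrt k%:R) (m + k) (x (m + k)%N)| <=
      C2 * (1 + M) * Num.sqrt m%:R / k%:R.
    have := incr k m (x (m + k)%N - x m) (x m) k0.
    rewrite subrK addnC => /le_trans; apply.
    rewrite ler_wpM2r ?invr_ge0 ?(ltW k1)// -mulrA ler_wpM2l//.
    by rewrite mulrDl mul1r lerD2l xM.
  rewrite (le_trans (ler_pM _ _ (p_bnd _ m0) h))//.
  have -> : C1 / Num.sqrt m%:R * (C2 * (1 + M) * Num.sqrt m%:R / k%:R) =
      C1 * (C2 * (1 + M)) / k%:R.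
    by field; rewrite !gt_eqF.
  by rewrite ler_wpM2r ?invr_ge0 ?(ltW k1)// /C lerDr !mulr_ge0.
have p_lim : Num.sqrt n%:R * fine (P (B n)) @[n --> \oo] -->
    D / (Num.sqrt (2 * pi) * sigma) * expR (- (kappa ^+ 2 / (2 * sigma ^+ 2))).
  have := local_limit mW iW iW2 EW EW2 tau0 c0 psi_bound x_lim.
  have -> : (Num.sqrt (2 * pi) * (sigma / D))^-1 *
      expR (- ((kappa / D) ^+ 2 / (2 * (sigma / D) ^+ 2))) =
      D / (Num.sqrt (2 * pi) * sigma) * expR (- (kappa ^+ 2 / (2 * sigma ^+ 2))).
    congr (_ * expR _); last by field; rewrite ?D1 ?s1.
    by rewrite mulrA invfM invrK mulrC.
  apply: cvg_trans; apply: near_eq_cvg; near=> n.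
  have n0 : (0 < n)%N by near: n; exists 1%N.
  by rewrite (pE n _ n0 (sqrtn_gt0 R n0)).
exact: (ae_log_average mB C0 cov1 cov2 p_lim).
Unshelve. all: by end_near. Qed.
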